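(* Let $(W,S)$ be a finite Coxeter system and $\theta$ an involutive automorphism of $(W,S)$. Then $\mathrm{Poin}(W;t)=\mathrm{Poin}(\iota(\theta);t)\,\mathrm{Poin}(\mathrm{Fix}(\theta);t)$ if and only if $m(s,\theta(s))\in\{1,2\}$ for all $s\in S$, i.e. if and only if $s$ commutes with $\theta(s)$ for every $s\in S$.
   Context: An automorphism of $(W,S)$ is a group automorphism of $W$ mapping $S$ onto $S$; involutive means $\theta^2=\mathrm{id}$; $m(s,s')$ is the order of $ss'$. Twisted identities $\iota(\theta)=\{\theta(w^{-1})w\mid w\in W\}$. For $w\in W$, $s\in S$: $w\star s=ws$ if $\theta(s)ws=w$, else $w\star s=\theta(s)ws$; every twisted identity equals $e\star s_1\star\cdots\star s_k$ (left to right from the identity $e$) for some $s_i\in S$, and $\rho(w)$ is the minimal such $k$. $\mathrm{Fix}(\theta)=\{w\in W\mid\theta(w)=w\}$ is a Coxeter group with canonical Coxeter generators $\{w_J\mid J=\{s,\theta(s)\},\ s\in S\}$, where $w_J$ is the longest element of the parabolic subgroup $W_J$; $\ell_\theta$ denotes length with respect to these generators. Poincaré polynomials: $\mathrm{Poin}(W;t)=\sum_{w\in W}t^{\ell(w)}$, $\mathrm{Poin}(\iota(\theta);t)=\sum_{w\in\iota(\theta)}t^{\rho(w)}$, $\mathrm{Poin}(\mathrm{Fix}(\theta);t)=\sum_{f\in\mathrm{Fix}(\theta)}t^{\ell_\theta(f)}$. *)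

(* Defs.v *)
From HB Require Import structures.
From mathcomp Require Import all_boot all_order all_algebra all_fingroup.

Set Implicit Arguments.
Unset Strict Implicit.
Unset Printing Implicit Defensive.

Import GroupScope.

Section MinimalWords.
Variable W : finGroupType.
Implicit Types (op : W -> W -> W) (A : {set W}) (w : W).

Definition reached_in op A (k : nat) w : bool :=
  [exists t : k.-tuple W, all [in A] t && (foldl op 1 t == w)].

(* The least k such that w = 1 op a_1 op ... op a_k (bracketed to the left)
   with all a_i in A.  By the pigeonhole principle the bound #|W| on the search
   is harmless whenever such a k exists: see min_stepsP and min_steps_le. *)
Definition min_steps op A w : nat :=
  find (fun k => reached_in op A k w) (iota 0 #|W|).

Lemma reached_inP op A k w :
  reflect (exists a : seq W,
            [/\ size a = k, {subset a <= A} & foldl op 1 a = w])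
          (reached_in op A k w).
Proof.
apply: (iffP existsP) => [[t /andP[/allP tA /eqP <-]]|[a [sz_a aA <-]]].
  by exists t; rewrite size_tuple.
have sz_a' : size a == k by apply/eqP.
by exists (Tuple sz_a'); rewrite /= eqxx andbT; apply/allP.
Qed.

Lemma reached_in_short op A k w :
  reached_in op A k w -> exists2 j, j < #|W| & reached_in op A j w.
Proof.
case/reached_inP=> a [_ aA <-] {k w}.
pose e := [rel x y | [exists b in A, op x b == y]].
have pathE x c : {subset c <= A} ->
    exists2 p, path e x p & last x p = foldl op x c.
  elim: c x => [|b c IHc] x cA /=; first by exists [::].
  have cA' : {subset c <= A} by move=> y yc; rewrite cA // inE yc orbT.
  have [p ep lp] := IHc (op x b) cA'; exists (op x b :: p) => //=.
  rewrite ep andbT; apply/existsP; exists b.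
  by rewrite cA ?inE ?eqxx.
have wordE x p : path e x p ->
    exists c, [/\ size c = size p, {subset c <= A} & foldl op x c = last x p].
  elim: p x => [|y p IHp] x /=; first by exists [::].
  case/andP=> /existsP[b /andP[bA /eqP <-]] /IHp[c [sz_c cA lc]].
  exists (b :: c); split=> //=; first by rewrite sz_c.
  by move=> z; rewrite inE => /predU1P[->|/cA].
have [p ep <-] := pathE 1 a aA.
case/shortenP: ep => q eq uq _.
have [c [sz_c cA <-]] := wordE _ _ eq.
exists (size q); last by apply/reached_inP; exists c.
by have := max_card [in 1 :: q]; rewrite (card_uniqP uq).
Qed.

Lemma min_stepsP op A k w :
  reached_in op A k w -> reached_in op A (min_steps op A w) w.
Proof.
case/reached_in_short=> j lt_j wj.
have has_w : has (fun k => reached_in op A k w) (iota 0 #|W|).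
  by apply/hasP; exists j; rewrite ?mem_iota.
have := nth_find 0 has_w; rewrite nth_iota //.
by rewrite -[X in _ < X](size_iota 0) -has_find.
Qed.

Lemma min_steps_le op A k w : reached_in op A k w -> min_steps op A w <= k.
Proof.
move=> wk; case: leqP => // lt_k.
have lt_kW : k < #|W|.
  by apply: leq_trans lt_k _; rewrite -[X in _ <= X](size_iota 0) find_size.
by have := before_find 0 lt_k; rewrite nth_iota // add0n wk.
Qed.

End MinimalWords.

Section Coxeter.
Variables (W : finGroupType) (S : {set W}).

(* Presentation of W by S subject to (s t)^m(s,t) = 1, where m(s,t) is the
   order of s t, stated as its universal property among all groups; the values of f
   outside S play no role. *)
Definition coxeter_system : Prop :=
  [/\ forall s, s \in S -> #[s] = 2,
      <<S>> = [set: W]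
    & forall (G : groupType) (f : W -> G),
        (forall s t, s \in S -> t \in S -> (f s * f t) ^+ #[s * t] = 1) ->
        exists2 phi : W -> G,
          {morph phi : x y / x * y} & {in S, phi =1 f}].

Definition word_length (A : {set W}) (w : W) : nat :=
  min_steps (fun x y => x * y) A w.

(* In a Coxeter system the longest element of a finite parabolic subgroup is
   unique, so the choice made by arg max is immaterial. *)
Definition longest (J : {set W}) : W :=
  [arg max_(w > 1 in <<J>>) word_length S w].

Variable theta : {perm W}.

Definition coxeter_aut : Prop :=
  theta \in Aut [set: W] /\ [set theta s | s in S] = S.

Definition twisted_identities : {set W} := [set theta (w^-1) * w | w : W].

Definition star (w s : W) : W :=
  if theta s * w * s == w then w * s else theta s * w * s.

Definition rho (w : W) : nat := min_steps star S w.

Definition fixed_points : {set W} := [set w | theta w == w].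

Definition fixed_gens : {set W} := [set longest [set s; theta s] | s in S].

End Coxeter.

Definition poincare (W : finGroupType) (A : {set W}) (len : W -> nat) :
    {poly int} :=
  (\sum_(w in A) 'X^(len w))%R.

(* Main.v *)
Require Import Defs.
From HB Require Import structures.
From mathcomp Require Import all_boot all_order all_algebra all_fingroup cyclic.
From mathcomp Require Import zify ring.

Set Implicit Arguments.
Unset Strict Implicit.
Unset Printing Implicit Defensive.

Import GroupScope.

(** If s and theta s always commute, the factorization is modelled on a count of flags
    over a field with q elements: when Sp_2n acts on the flags of GL_2n, its orbits are indexed
    by the twisted identities x, the orbit of x has q^rho(x) times as many points as the
    closed orbit, and the closed orbit is the flag variety of Sp_2n, whose Bruhat cells
    are indexed by Fix(theta) and have q^l_theta(f) points.  We run this argument for an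
    abstract W on the module of functions on the twisted identities, with Hecke operators
    T_s over Z[q]; the main point is the braid relation, which holds because finiteness
    of W makes every reflection r commute with theta r.  Put P(w) = T_w delta_1.  Then
    sum_x P(w)(x) q^rho(x) = q^l(w); the sum over w of P(w) is T_s-invariant, hence
    constant; and P(w)(1) is q^l_theta(w) if theta w = w and 0 otherwise, since P(w)(y) <> 0
    forces T_w to occur in T_y T_theta(w).

    Conversely, in degree 1 the factorization says that |S| is the number of twisted
    identities of rank 1 plus the number of theta-orbits on S; each orbit of two
    non-commuting generators contributes 3 instead of 2 to the right-hand side. *)

(** * Words and the inversion cocycle *)

Section WordLength.
Variables (gT : finGroupType) (A : {set gT}).
Implicit Types (a : seq gT) (w : gT).

Local Notation prodw a := (\prod_(s <- a) s).

Lemma word_length_le a : {subset a <= A} -> word_length A (prodw a) <= size a.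
Proof.
move=> aA; apply: min_steps_le; apply/reached_inP; exists a; split=> //.
exact: (foldl_idx *%g a).
Qed.

Lemma word_lengthP w : w \in <<A>> ->
  exists a, [/\ size a = word_length A w, {subset a <= A} & prodw a = w].
Proof.
case/gen_prodgP=> k [c cA ->]; set x := \prod_i c i.
pose a := [seq c i | i <- index_enum 'I_k].
have xk : reached_in (fun x y => x * y) A (size a) x.
  apply/reached_inP; exists a; split=> // [_ /mapP[i _ ->]//|].
  by rewrite (foldl_idx *%g) big_map.
have /reached_inP[b [szb bA bx]] := min_stepsP xk.
by exists b; split=> //; rewrite -bx -(foldl_idx *%g b).
Qed.

Lemma word_length1 : word_length A 1 = 0.
Proof.
by have := @word_length_le [::]; rewrite big_nil leqn0 => le0; apply/eqP/le0.
Qed.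

Lemma word_length_eq0 w : w \in <<A>> -> (word_length A w == 0) = (w == 1).
Proof.
move=> wA; apply/eqP/eqP => [lw|->]; last exact: word_length1.
have [[|? ?] [sza _ <-]] := word_lengthP wA; last by rewrite lw in sza.
by rewrite big_nil.
Qed.

End WordLength.

Section InversionCocycle.
Variable W : finGroupType.
Implicit Types r s t : W.

(* The action of W on signed reflections that yields the cocycle; it is defined on signed
   elements of W so as to be a permutation of a finType. *)
Lemma signed_conj_inj s :
  injective (fun p : W * bool => (p.1 ^ s, p.2 (+) (p.1 == s))).
Proof.
by case=> [r e] [r' e'] /= [/conjg_inj-> /eqP]; rewrite (can_eq (addbK _)) => /eqP->.
Qed.

Definition signed_conj s : {perm W * bool} := perm (@signed_conj_inj s).

Lemma dihedral_conj s t k : s * s = 1 -> t * t = 1 ->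
  (s * t) ^+ k * s * (s * t) ^- k = (s * t) ^+ k.*2 * s.
Proof.
move=> ss tt.
have sV : s^-1 = s by apply: (mulgI s); rewrite mulgV.
have tV : t^-1 = t by apply: (mulgI t); rewrite mulgV.
have stJ : (s * t) ^ s = (s * t)^-1.
  by rewrite conjgE invMg sV tV !mulgA ss mul1g.
rewrite -addnn expgD -!mulgA; congr (_ * _).
by rewrite -expVgn -stJ -conjXg conjgE sV !mulgA ss mul1g.
Qed.

(** The sign of r flips once for every j < 2k with r = (s t)^j s. When k is the order of s t these
    elements repeat with period k, so the flips cancel in pairs. *)
Lemma signed_conj_braid s t : s * s = 1 -> t * t = 1 ->
  (signed_conj s * signed_conj t) ^+ #[s * t] = 1.
Proof.
move=> ss tt; pose F r j : nat := r == (s * t) ^+ j * s.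
have iterE k r e : ((signed_conj s * signed_conj t) ^+ k) (r, e) =
    (r ^ ((s * t) ^+ k), e (+) odd (\sum_(j < k.*2) F r j)).
  elim: k => [|k IHk]; first by rewrite !expg0 perm1 conjg1 big_ord0 addbF.
  rewrite !expgSr !permM IHk !permE /= -!conjgM; congr (_, _).
  rewrite -!addbA doubleS !big_ord_recr /= !oddD -!addbA; congr (_ (+) (_ (+) _)).
  have eqJ x y : (r ^ x == y) = (r == x * y * x^-1).
    by rewrite -(inj_eq (@conjg_inj _ x^-1)) conjgK /conjg invgK mulgA.
  rewrite !oddb !eqJ /F; congr (_ (+) _).
    by rewrite dihedral_conj.
  have sV : s^-1 = s by apply: (mulgI s); rewrite mulgV.
  rewrite invMg sV expgS -[in RHS]mulgA -dihedral_conj // !mulgA.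
  have := commuteX k (commute_refl (s * t)); set z := _ ^+ k => cz.
  by rewrite cz !mulgA.
apply/permP=> [[r e]]; rewrite iterE perm1 expg_order conjg1.
rewrite -addnn big_split_ord /= oddD.
rewrite [X in odd _ (+) odd X](eq_bigr (fun i : 'I__ => F r i)) => [|i _].
  by rewrite addbb addbF.
by rewrite /F expgD expg_order mul1g.
Qed.

End InversionCocycle.

Section CocycleExistence.
Variables (W : finGroupType) (S : {set W}).
Implicit Types (a b : seq W) (r s t u v w x y : W) (J : {set W}).

Local Notation prodw a := (\prod_(s <- a) s).

(* n w r tells whether the reflection r is a left inversion of w, that is, whether
   l(rw) < l(w); being a cocycle in w, it makes sense for every r in W. *)
Definition inversion_cocycle (n : W -> W -> bool) : Prop :=
  (forall s r, s \in S -> n s r = (r == s)) /\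
  (forall v w r, n (v * w) r = n v r (+) n w (r ^ v)).

(** The universal property extends [signed_conj] to W, and the sign that [phi w] attaches to r is
    the cocycle. Its cocycle identity is the multiplicativity of [phi], because the change of sign
    does not depend on the incoming sign. *)
Lemma inversion_cocycle_ex : coxeter_system S -> exists n, inversion_cocycle n.
Proof.
case=> S2 Sgen univ.
have ss s : s \in S -> s * s = 1 by move/S2=> s2; rewrite -(expg_order s) s2.
case: (univ {perm W * bool} (@signed_conj W)) => [s t sS tS|phi phiM phiS].
  by apply: signed_conj_braid; exact: ss.
have phi1 : phi 1 = 1 by apply: (mulgI (phi 1)); rewrite -phiM !mulg1.
pose n w r := (phi w (r, false)).2.
have phiE w r e : phi w (r, e) = (r ^ w, e (+) n w r).
  have : w \in <<S>> by rewrite Sgen inE.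
  case/word_lengthP=> a [_ aS <-] {w}; rewrite /n.
  elim: a aS r e => [|s a IHa] aS r e.
    by rewrite big_nil phi1 !perm1 conjg1 addbF.
  have aS' : {subset a <= S} by move=> x ax; rewrite aS // inE ax orbT.
  rewrite big_cons phiM !permM (phiS s) ?aS ?mem_head // !permE /=.
  by rewrite (IHa aS' _ (e (+) _)) (IHa aS' _ (r == s)) conjgM addbA.
exists n; split=> [s r sS|v w r]; first by rewrite /n phiS // permE.
by rewrite /n phiM permM phiE addFb phiE.
Qed.

End CocycleExistence.

(** * Length, parabolic subgroups and dihedral subgroups *)

Section Coxeter.
Variables (W : finGroupType) (S : {set W}).
Implicit Types (a b : seq W) (r s t u w x y f : W) (J : {set W}).

Local Notation prodw a := (\prod_(s <- a) s).
Local Notation len := (word_length S).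

Hypotheses (S2 : forall s, s \in S -> s * s = 1) (Sgen : <<S>> = [set: W]).
Variable n : W -> W -> bool.
Hypothesis n_cocycle : inversion_cocycle S n.
Let n_gen s r : s \in S -> n s r = (r == s). Proof. exact: n_cocycle.1. Qed.
Let nM v w r : n (v * w) r = n v r (+) n w (r ^ v).
Proof. exact: n_cocycle.2. Qed.

Lemma invS s : s \in S -> s^-1 = s.
Proof. by move=> sS; apply: (mulgI s); rewrite mulgV S2. Qed.

Lemma inversion1 r : n 1 r = false.
Proof. by have := nM 1 1 r; rewrite mulg1 conjg1 addbb. Qed.

Lemma inversion_gen s w r : s \in S -> n (s * w) r = (r == s) (+) n w (r ^ s).
Proof. by move=> sS; rewrite nM n_gen. Qed.

Lemma inversion_gen_self s w : s \in S -> n (s * w) s = ~~ n w s.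
Proof. by move=> sS; rewrite inversion_gen // eqxx conjgE mulKg addTb. Qed.

Lemma inversionV w r : n w^-1 r = n w (r ^ w^-1).
Proof.
by have := nM w^-1 w r; rewrite mulVg inversion1; case: n; case: n.
Qed.

Lemma reducedP w :
  exists a, [/\ size a = len w, {subset a <= S} & prodw a = w].
Proof. by apply: word_lengthP; rewrite Sgen inE. Qed.

Lemma len_le a : {subset a <= S} -> len (prodw a) <= size a.
Proof. exact: word_length_le. Qed.

Lemma sub_cons s a J : {subset s :: a <= J} -> s \in J /\ {subset a <= J}.
Proof.
by move=> saJ; split=> [|x xa]; apply: saJ; rewrite inE ?eqxx // xa orbT.
Qed.

Lemma sub_cat a b J :
  {subset a ++ b <= J} -> {subset a <= J} /\ {subset b <= J}.
Proof. by move=> abJ; split=> x xab; apply: abJ; rewrite mem_cat xab ?orbT. Qed.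

Lemma cat_sub a b J :
  {subset a <= J} -> {subset b <= J} -> {subset a ++ b <= J}.
Proof. by move=> aJ bJ x; rewrite mem_cat => /orP[/aJ|/bJ]. Qed.

Lemma prodw_gen a J : {subset a <= J} -> prodw a \in <<J>>.
Proof.
by move=> aJ; rewrite big_seq; apply: group_prod => s sa; rewrite mem_gen ?aJ.
Qed.

(** Along a word the cocycle is a sum of indicators, one per letter. A nonzero term at r makes r the
    conjugate of that letter by its prefix, and left multiplication by r then deletes the letter
    ([exchange_prod]). *)
Lemma strong_exchange a r : {subset a <= S} -> n (prodw a) r ->
  exists a1 s a2, a = a1 ++ s :: a2 /\ r = s ^ (prodw a1)^-1.
Proof.
elim: a r => [|s a IHa] r; first by rewrite big_nil inversion1.
case/sub_cons=> sS aS; rewrite big_cons inversion_gen //.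
case: eqP => [-> _|_ /= /(IHa _ aS)[a1 [t [a2 [-> rs]]]]].
  by exists [::], s, a; rewrite big_nil invg1 conjg1.
exists (s :: a1), t, a2; split=> //.
by rewrite big_cons invMg conjgM -rs conjgK.
Qed.

Lemma exchange_prod a1 s a2 : s \in S ->
  s ^ (prodw a1)^-1 * prodw (a1 ++ s :: a2) = prodw (a1 ++ a2).
Proof.
move=> sS; rewrite !big_cat big_cons /= conjgE invgK -!mulgA mulKg.
by rewrite (mulgA s) S2 // mul1g.
Qed.

Definition reflection r := r \in class_support S [set: W].

Lemma reflectionP r : reflect (exists2 s, s \in S & exists g, r = s ^ g) (reflection r).
Proof.
apply: (iffP imset2P) => [[s g sS _ ->]|[s sS [g ->]]]; first by exists s; last exists g.
by exists s g; rewrite ?inE.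
Qed.

Lemma reflection_gen s : s \in S -> reflection s.
Proof. by move=> sS; apply/reflectionP; exists s; last exists 1; rewrite ?conjg1. Qed.

Lemma reflectionJ r g : reflection r -> reflection (r ^ g).
Proof.
case/reflectionP=> s sS [h ->]; apply/reflectionP; exists s => //.
by exists (h * g); rewrite conjgM.
Qed.

Lemma inversion_self r : reflection r -> n r r.
Proof.
case/reflectionP=> s sS [g ->]; rewrite {1}conjgE nM inversion_gen // inversionV.
by rewrite conjgK eqxx [s ^ s]conjgE mulKg; case: n.
Qed.

Lemma reflection_sqr r : reflection r -> r * r = 1.
Proof. by case/reflectionP=> s sS [g ->]; rewrite -conjMg S2 // conj1g. Qed.

Lemma inversion_mul_reflection r w : reflection r -> n (r * w) r = ~~ n w r.
Proof. by move=> rr; rewrite nM inversion_self // conjgE mulKg addTb. Qed.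

Lemma inversion_len w r : n w r -> len (r * w) < len w.
Proof.
have [a [<- aS <-]] := reducedP w.
case/(strong_exchange aS) => a1 [s [a2 [defa ->]]]; subst a.
have [a1S /sub_cons[sS a2S]] := sub_cat aS.
rewrite exchange_prod // (leq_ltn_trans (len_le _)) //; first exact: cat_sub.
by rewrite !size_cat addnS.
Qed.

Lemma noninversion_len w r : reflection r -> ~~ n w r -> len w < len (r * w).
Proof.
move=> rr; rewrite -inversion_mul_reflection // => /inversion_len.
by rewrite mulgA reflection_sqr // mul1g.
Qed.

Lemma len_mul v w : len (v * w) <= len v + len w.
Proof.
have [a [<- aS <-]] := reducedP v; have [b [<- bS <-]] := reducedP w.
by rewrite -big_cat -size_cat len_le //; apply: cat_sub.
Qed.

Lemma len_gen s : s \in S -> len s <= 1.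
Proof. by move=> sS; have := @len_le [:: s]; rewrite big_seq1; apply=> t /[!inE]/eqP->. Qed.

Lemma len1 : len 1 = 0. Proof. exact: word_length1. Qed.

Lemma len_eq0 w : (len w == 0) = (w == 1).
Proof. by apply: word_length_eq0; rewrite Sgen inE. Qed.

Lemma len_asc s w : s \in S -> ~~ n w s -> len (s * w) = (len w).+1.
Proof.
move=> sS nws; apply/eqP; rewrite eqn_leq noninversion_len ?reflection_gen //.
by rewrite (leq_trans (len_mul _ _)) // -add1n leq_add2r len_gen.
Qed.

Lemma len_desc s w : s \in S -> n w s -> len w = (len (s * w)).+1.
Proof.
move=> sS nws; rewrite -(len_asc sS) ?inversion_gen_self ?nws //.
by rewrite mulgA S2 // mul1g.
Qed.

Lemma lenV w : len w^-1 = len w.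
Proof.
suff leV x : len x^-1 <= len x by apply/eqP; rewrite eqn_leq leV -{1}(invgK w) leV.
have [a [<- aS <-]] := reducedP x; elim: a aS => [|s a IHa].
  by rewrite big_nil invg1 len1.
case/sub_cons=> sS aS; rewrite big_cons invMg.
rewrite (leq_trans (len_mul _ _)) //= -addn1 leq_add ?IHa //.
by rewrite invS // len_gen.
Qed.

Section Parabolic.
Variable J : {set W}.
Hypothesis JS : J \subset S.

(** Take for s the first letter of a word for g that is shortest among the words over J. Were s not
    a descent, it would be an inversion of the remaining product, and exchange would yield a shorter
    word over J. *)
Lemma descent_parabolic g : g \in <<J>> -> g != 1 -> exists2 s, s \in J & n g s.
Proof.
move=> gJ; have [[|s a] [sza aJ defg]] := word_lengthP gJ.
  by rewrite -defg big_nil eqxx.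
move=> _; have [sJ aJ'] := sub_cons aJ.
have sS := subsetP JS _ sJ; exists s => //.
rewrite -defg big_cons inversion_gen_self //; apply/negP.
case/strong_exchange=> [x /aJ' /(subsetP JS) //|a1 [t [a2 [defa defs]]]].
have [a1J /sub_cons[tJ a2J]] : {subset a1 <= J} /\ {subset t :: a2 <= J}.
  by apply: sub_cat; rewrite -defa.
have: word_length J g <= size (a1 ++ a2).
  rewrite -defg big_cons {1}defs defa exchange_prod ?(subsetP JS) //.
  by apply: word_length_le; apply: cat_sub.
by rewrite -sza defa /= !size_cat /= addnS ltnNge leqnSn.
Qed.

Lemma inversion_parabolic g r : g \in <<J>> -> n g r -> r \in <<J>>.
Proof.
case/word_lengthP=> a [_ aJ <-].
case/strong_exchange=> [x /aJ /(subsetP JS) //|a1 [t [a2 [defa ->]]]].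
have [a1J /sub_cons[tJ _]] : {subset a1 <= J} /\ {subset t :: a2 <= J}.
  by apply: sub_cat; rewrite -defa.
by apply: groupJ; [apply: mem_gen | rewrite groupV prodw_gen].
Qed.

Lemma parabolic_gen s : s \in S -> s \in <<J>> -> s \in J.
Proof.
move=> sS sJ; have s1 : s != 1.
  apply/eqP=> s1; have := inversion_self (reflection_gen sS).
  by rewrite {1}s1 inversion1.
by have [t tJ] := descent_parabolic sJ s1; rewrite n_gen // => /eqP <-.
Qed.

(* The cocycle makes an element whose simple inversions in J are all (or all not)
   inversions the unique longest (or shortest) element of its coset. *)
Lemma coset_extremal (c : bool) u g :
    (forall r, reflection r -> r \in <<J>> -> n u r = c) ->
    g \in <<J>> -> (forall s, s \in J -> n (g * u) s = c) ->
  g = 1.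
Proof.
move=> uc gJ guc; apply: contraTeq isT => /(descent_parabolic gJ)[s sJ ngs].
have sS := subsetP JS _ sJ.
have := guc s sJ; rewrite nM ngs uc; first by case: c {uc guc}.
  by apply/reflectionJ; apply: reflection_gen.
by apply: groupJ => //; apply: mem_gen.
Qed.

(** A shortest element of the coset W_J v inverts no reflection of W_J, and [coset_extremal]
    identifies it with v. *)
Lemma coset_min v : (forall s, s \in J -> ~~ n v s) ->
  forall r, reflection r -> r \in <<J>> -> ~~ n v r.
Proof.
move=> vJ; pose P g := g \in <<J>>.
have P1 : P 1 by apply: group1.
case: (arg_minnP (fun g => len (g * v)) P1) => g gJ gmin.
have gvJ r : reflection r -> r \in <<J>> -> n (g * v) r = false.
  move=> rr rJ; apply/negP=> /inversion_len; rewrite ltnNge mulgA gmin //.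
  exact: groupM.
have g1 : g^-1 = 1.
  apply: (coset_extremal gvJ); rewrite ?groupV // => s sJ.
  by rewrite mulKg (negbTE (vJ s sJ)).
move=> r rr rJ; have := gvJ r rr rJ.
by rewrite -[g]invgK g1 invg1 mul1g => ->.
Qed.

Lemma coset_max v : (forall s, s \in J -> n v s) ->
  forall r, reflection r -> r \in <<J>> -> n v r.
Proof.
move=> vJ; pose P g := g \in <<J>>.
have P1 : P 1 by apply: group1.
case: (arg_maxnP (fun g => len (g * v)) P1) => g gJ gmax.
have gvJ r : reflection r -> r \in <<J>> -> n (g * v) r = true.
  move=> rr rJ; apply: contraT => /(noninversion_len rr).
  by rewrite mulgA ltnNge => /negP[]; apply: gmax; apply: groupM.
have g1 : g^-1 = 1.
  by apply: (coset_extremal gvJ); rewrite ?groupV // => s sJ; rewrite mulKg vJ.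
move=> r rr rJ; have := gvJ r rr rJ.
by rewrite -[g]invgK g1 invg1 mul1g.
Qed.

Lemma inversion_coset g v s : (forall s, s \in J -> ~~ n v s) ->
  g \in <<J>> -> s \in J -> n (g * v) s = n g s.
Proof.
move=> vJ gJ sJ; rewrite nM (negbTE (coset_min vJ _ _)) ?addbF //.
  by apply/reflectionJ; apply: reflection_gen; apply: (subsetP JS).
by apply: groupJ => //; apply: mem_gen.
Qed.

Lemma len_coset g v : (forall s, s \in J -> ~~ n v s) -> g \in <<J>> ->
  len (g * v) = len g + len v.
Proof.
move=> vJ; have [k] := ubnP (len g); elim: k g => // k IHk g ltgk gJ.
have [->|g1] := eqVneq g 1; first by rewrite mul1g len1.
have [s sJ ngs] := descent_parabolic gJ g1; have sS := subsetP JS _ sJ.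
rewrite (len_desc sS ngs) (@len_desc s (g * v)) ?inversion_coset //.
have sgJ : s * g \in <<J>> by apply: groupM => //; apply: mem_gen.
by rewrite mulgA IHk // -ltnS -(len_desc sS ngs).
Qed.

End Parabolic.

Lemma descent_ex w : w != 1 -> exists2 s, s \in S & n w s.
Proof. by apply: (descent_parabolic (subxx S)); rewrite Sgen inE. Qed.

(** By g y = y g^y, the element s^y is an inversion of g^y, hence lies in W_J'. Lengths add on both
    sides of s y = y s^y, so s^y has length 1 and is a generator. *)
Lemma double_coset_descent J J' y g s :
    J \subset S -> J' \subset S -> (forall t, t \in J -> ~~ n y t) ->
    (forall t, t \in J' -> ~~ n y^-1 t) ->
    g \in <<J>> -> g ^ y \in <<J'>> -> s \in J -> n g s ->
  s ^ y \in J'.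
Proof.
move=> JS J'S yJ yJ' gJ gyJ' sJ ngs; have sS := subsetP JS _ sJ.
have := inversion_coset JS yJ gJ sJ; rewrite ngs conjgC nM (negbTE (yJ s sJ)) /=.
move/(inversion_parabolic J'S gyJ'); set h := s ^ y => hJ'.
have lenh : len h = 1%N.
  have := len_asc sS (yJ s sJ); rewrite conjgC -/h -lenV invMg (len_coset J'S yJ') ?groupV //.
  by rewrite !lenV; lia.
have h1 : h != 1 by rewrite -len_eq0 lenh.
have [t tJ' nht] := descent_parabolic J'S hJ' h1.
have tS := subsetP J'S _ tJ'.
have /eqP := len_desc tS nht; rewrite lenh eqSS eq_sym len_eq0.
by move/eqP => th1; rewrite -(mulKg t h) th1 mulg1 invS.
Qed.

Fixpoint alternating s t k := if k is k'.+1 then s :: alternating t s k' else [::].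

Lemma size_alternating s t k : size (alternating s t k) = k.
Proof. by elim: k s t => //= k IHk s t; rewrite IHk. Qed.

Lemma alternating_sub s t k J : s \in J -> t \in J -> {subset alternating s t k <= J}.
Proof.
elim: k s t => [|k IHk] s t sJ tJ //= x; rewrite inE => /predU1P[-> //|].
exact: IHk.
Qed.

Lemma alternatingS s t k :
  alternating s t k.+1 = rcons (alternating s t k) (if odd k then t else s).
Proof.
elim: k s t => // k IHk s t; rewrite -[LHS]/(s :: alternating t s k.+1) IHk /=.
by case: (odd k).
Qed.

Lemma alternatingD s t k m : exists2 c,
  alternating s t (k + m) = alternating s t k ++ c & size c = m.
Proof.
elim: k s t => [|k IHk] s t; first by exists (alternating s t m); rewrite ?size_alternating.
by have [c defc szc] := IHk t s; exists c; rewrite //= defc.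
Qed.

Lemma prod_alternating s t k : s \in S -> t \in S ->
  prodw (alternating s t k) = (s * t) ^+ k * prodw (alternating t s k).
Proof.
elim: k s t => [|k IHk] s t sS tS; first by rewrite mul1g.
have mulX : s * (t * s) ^+ k = (s * t) ^+ k * s.
  elim: k {IHk} => [|k IHk]; first by rewrite mulg1 mul1g.
  by rewrite expgSr mulgA IHk expgSr !mulgA.
rewrite -[alternating s t _]/(s :: _) -[alternating t s _.+1]/(t :: _) !big_cons.
rewrite IHk // mulgA mulX expgSr -!mulgA; congr (_ * (_ * _)).
by rewrite mulgA S2 // mul1g.
Qed.

Lemma prod_alternating_braid s t : s \in S -> t \in S ->
  prodw (alternating s t #[s * t]) = prodw (alternating t s #[s * t]).
Proof. by move=> sS tS; rewrite prod_alternating // expg_order mul1g. Qed.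

(** The disjunction excludes that t is the only descent among s and t. It passes to s w with the two
    generators exchanged, since s is not a descent of s w. *)
Lemma strip_alternating s t w : s \in S -> t \in S -> n w s || ~~ n w t ->
  exists k v, [/\ w = prodw (alternating s t k) * v, len w = k + len v,
                  ~~ n v s & ~~ n v t].
Proof.
have [m] := ubnP (len w); elim: m w s t => // m IHm w s t ltm sS tS.
have [nws _|nws /= nwt] := boolP (n w s); last first.
  by exists 0, w; rewrite big_nil mul1g.
have [||k [v [defw lw nvt nvs]]] := IHm (s * w) t s _ tS sS.
- by rewrite -ltnS -(len_desc sS nws).
- by rewrite inversion_gen_self // nws orbT.
exists k.+1, v; split=> //.
  by rewrite big_cons -mulgA -defw mulgA S2 // mul1g.
by rewrite (len_desc sS nws) lw.
Qed.

(** Stripping from s and from t reaches the same minimal coset representative, so the two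
    alternating words of some length k > 0 have equal products. Then (s t)^k = 1, and the order of s
    t is at most k. *)
Lemma dihedral_descent s t w : s \in S -> t \in S -> n w s -> n w t ->
  exists v, w = prodw (alternating s t #[s * t]) * v
            /\ len w = #[s * t] + len v.
Proof.
move=> sS tS nws nwt.
have [|k [v [defw lw nvs nvt]]] := @strip_alternating s t w sS tS.
  by rewrite nws.
have [|k' [v' [defw' lw' nv's nv't]]] := @strip_alternating t s w tS sS.
  by rewrite nwt.
have JS : [set s; t] \subset S by apply/subsetP=> x /set2P[]->.
have sJ : s \in [set s; t] by rewrite set21.
have tJ : t \in [set s; t] by rewrite set22.
have altJ x y j : x \in [set s; t] -> y \in [set s; t] ->
    prodw (alternating x y j) \in <<[set s; t]>>.
  by move=> xJ yJ; apply/prodw_gen/alternating_sub.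
have defv : (prodw (alternating t s k'))^-1 * prodw (alternating s t k) * v = v'.
  by rewrite -mulgA -defw defw' mulKg.
have nJ u : ~~ n u s -> ~~ n u t -> forall x, x \in [set s; t] -> ~~ n u x.
  by move=> nus nut x /set2P[]->.
have noJ r : reflection r -> r \in <<[set s; t]>> -> n v r = false.
  by move=> rr rJ; apply/negbTE/(coset_min JS (nJ v nvs nvt)).
have g1 : (prodw (alternating t s k'))^-1 * prodw (alternating s t k) = 1.
  apply: (coset_extremal JS noJ).
    by apply: groupM; rewrite ?groupV; apply: altJ.
  by move=> x xJ; rewrite defv; apply/negbTE/(nJ v').
have vv' : v = v' by rewrite -defv g1 mul1g.
have kk' : k = k' by apply/eqP; rewrite -(eqn_add2r (len v)) -lw {1}vv' -lw'.
have k_gt0 : 0 < k.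
  by case: k defw {lw defv g1 kk'} => // defw; rewrite defw big_nil mul1g (negbTE nvs) in nws.
have : #[s * t] <= k.
  apply: dvdn_leq => //; rewrite order_dvdn; apply/eqP.
  apply: (mulIg (prodw (alternating t s k))); rewrite -prod_alternating // mul1g.
  by apply: (mulgI (prodw (alternating t s k'))^-1); rewrite g1 kk' mulVg.
move/subnKC => defk; have [c defc szc] := alternatingD s t #[s * t] (k - #[s * t]).
rewrite defk in defc; exists (prodw c * v).
have wE : w = prodw (alternating s t #[s * t]) * (prodw c * v).
  by rewrite mulgA defw defc big_cat.
split=> //; apply/eqP; rewrite eqn_leq {1}wE (leq_trans (len_mul _ _)).
  rewrite lw -defk -addnA leq_add2l (leq_trans (len_mul _ _)) // leq_add2r -szc.
  apply: len_le; apply: (proj2 (sub_cat (a := alternating s t #[s * t]) _)).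
  by rewrite -defc; apply: alternating_sub.
rewrite leq_add2r -{2}(size_alternating s t #[s * t]).
by apply/len_le/alternating_sub.
Qed.

(** * Matsumoto's theorem for operators satisfying the braid relations *)

Section Matsumoto.
Variables (M : Type) (T : W -> M -> M) (stable : M -> Prop).
Hypothesis stableT : forall s m, s \in S -> stable m -> stable (T s m).
Hypothesis braid : forall s t m, s \in S -> t \in S -> stable m ->
  foldr T m (alternating s t #[s * t]) = foldr T m (alternating t s #[s * t]).

Lemma stable_foldr a m : {subset a <= S} -> stable m -> stable (foldr T m a).
Proof.
by move=> + mI; elim: a => //= s a IHa /sub_cons[sS aS]; auto.
Qed.

Lemma reduced_cons s a : {subset s :: a <= S} -> size (s :: a) = len (prodw (s :: a)) ->
  size a = len (prodw a) /\ n (prodw (s :: a)) s.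
Proof.
case/sub_cons=> sS aS; rewrite big_cons /= => sza.
have lea := len_le aS.
have nas : n (s * prodw a) s.
  apply: contraT; rewrite inversion_gen_self // negbK => nas.
  have := len_desc sS nas.
  by rewrite -sza => lp; move: lea; rewrite lp ltnNge leqnSn.
split=> //; have := len_desc sS nas.
by rewrite mulgA S2 // mul1g -sza => -[].
Qed.

(** If the words begin with s and t, their product has both descents and so begins with the longest
    dihedral word, which can be written starting with s or with t. Each word is compared with the
    version sharing its first letter, and one braid relation links the two versions. *)
Lemma matsumoto a b m : stable m -> {subset a <= S} -> {subset b <= S} ->
    size a = len (prodw a) -> size b = len (prodw b) -> prodw a = prodw b ->
  foldr T m a = foldr T m b.
Proof.
move=> mI; have [k] := ubnP (size a); elim: k a b => // k IHk a b ltk aS bS sza szb ab.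
have szab : size a = size b by rewrite sza ab.
case: a b => [|s a] [|t b] // in ltk aS bS sza szb ab szab *.
have [sza' nws] := reduced_cons aS sza; have [szb' nwt] := reduced_cons bS szb.
have [sS aS'] := sub_cons aS; have [tS bS'] := sub_cons bS.
rewrite -ab in nwt.
have [v [defw lw]] := dihedral_descent sS tS nws nwt.
have [c [szc cS defv]] := reducedP v.
(* [x :: d] and [alternating x y #[s * t] ++ c] are reduced words for one element with a common
   first letter, so induction applies to their tails. *)
have key x y d : x \in S -> y \in S -> prodw (x :: d) = prodw (s :: a) ->
    prodw (s :: a) = prodw (alternating x y #[s * t]) * v -> {subset d <= S} ->
    size d = len (prodw d) -> size d < k -> size (x :: d) = size (s :: a) ->
    foldr T m (x :: d) = foldr T (foldr T m c) (alternating x y #[s * t]).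
  move=> xS yS defd defw' dS szd ltd sizd.
  case: #[s * t] (order_gt0 (s * t)) defw' lw => // j _ defw' lw.
  pose e := alternating y x j ++ c.
  have eS : {subset e <= S} by apply: cat_sub => //; apply: alternating_sub.
  have de : prodw d = prodw e.
    apply: (mulgI x); have -> : x * prodw d = prodw (x :: d) by rewrite big_cons.
    by rewrite defd defw' -defv /= big_cons big_cat /= mulgA.
  rewrite -foldr_cat /=; congr (T x _); apply: IHk => //.
  rewrite -de -szd size_cat size_alternating szc.
  by move: sizd; rewrite sza lw addSn => -[].
have ->: foldr T m (s :: a) = foldr T (foldr T m c) (alternating s t #[s * t]).
  by apply: key.
rewrite braid //; last exact: stable_foldr.
apply: esym; apply: key => //; last by move: szab ltk => /= [->].
by rewrite defw prod_alternating_braid.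
Qed.

End Matsumoto.

Lemma longestP J : J \subset S ->
  longest S J \in <<J>> /\ forall s, s \in J -> n (longest S J) s.
Proof.
move=> JS; rewrite /longest; case: arg_maxnP => [|w wJ wmax]; first exact: group1.
split=> // s sJ; have sS := subsetP JS _ sJ.
apply: contraT => /(noninversion_len (reflection_gen sS)).
rewrite ltnNge => /negP[]; apply: wmax.
by apply: groupM => //; apply: mem_gen.
Qed.

Lemma longest_unique J u : J \subset S -> u \in <<J>> ->
  (forall s, s \in J -> n u s) -> u = longest S J.
Proof.
move=> JS uJ uall; have [wJ wall] := longestP JS.
have umax := coset_max JS uall.
have /eqP : longest S J * u^-1 = 1.
  apply: (coset_extremal JS umax); first by rewrite groupM ?groupV.
  by move=> s sJ; rewrite mulgKV wall.
by rewrite -eq_invg_mul => /eqP/invg_inj.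
Qed.

(* [right_support y b w]: T_w occurs in the product T_y T_b in the Hecke algebra, whose
   structure constants are polynomials in q and q - 1 without cancellation. *)
Fixpoint right_support y b w : bool :=
  if b is t :: b' then
    right_support (y * t) b' w || n y^-1 t && right_support y b' w
  else y == w.

(** A letter raises the length by at most 1, so the assumed equality makes every letter an ascent.
    The branch of [right_support] that keeps y is then closed at each step, and one basis element
    remains. *)
Lemma right_support_reduced y b w : {subset b <= S} ->
  len (y * prodw b) = len y + size b -> right_support y b w -> w = y * prodw b.
Proof.
elim: b y => [|t b IHb] y bS; first by rewrite big_nil mulg1 => _ /eqP.
have [tS bS'] := sub_cons bS; rewrite big_cons mulgA /= addnS => lenytb.
have lenyt : len (y * t) <= (len y).+1.
  by rewrite (leq_trans (len_mul _ _)) // -addn1 leq_add2l len_gen.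
have lenyt' : len (y * t * prodw b) <= len (y * t) + size b.
  by rewrite (leq_trans (len_mul _ _)) // leq_add2l len_le.
have lenE : len (y * t) = (len y).+1.
  apply/eqP; rewrite eqn_leq lenyt -(leq_add2r (size b)) addSn -lenytb.
  exact: lenyt'.
case/orP=> [|/andP[nyt _]]; first by apply: IHb => //; rewrite lenytb lenE addSn.
have := len_desc tS nyt.
rewrite lenV -{1}(invS tS) -invMg lenV lenE => /eqP.
by rewrite -addn2 -[X in X == _]addn0 eqn_add2l.
Qed.

(** As s is an ascent of y, T_(sy) = T_s T_y; and T_u occurs in T_s T_v exactly when v = s u, or v =
    u and s is a descent of u. The induction on b lets the left and right multiplications
    commute. *)
Lemma right_support_mull s y b u : s \in S -> {subset b <= S} -> ~~ n y s ->
  right_support (s * y) b u =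
  right_support y b (s * u) || right_support y b u && n u s.
Proof.
move=> sS; elim: b y u => [|t b IHb] y u bS nys /=.
  have -> : (s * y == u) = (y == s * u).
    by rewrite -(inj_eq (mulgI s)) mulgA S2 // mul1g.
  by case: (eqVneq y u) nys => [-> /negbTE->|_ _]; rewrite ?andbF ?orbF.
have [tS bS'] := sub_cons bS.
have eq_ts : (t ^ y^-1 == s) = (s * y == y * t).
  by rewrite conjgE invgK mulgA -(inj_eq (mulIg y)) mulgKV eq_sym.
have eq_st : (s ^ y == t) = (s * y == y * t).
  by rewrite conjgE -(inj_eq (mulgI y)) mulKVg.
have nsyt : n (s * y)^-1 t = n y^-1 t (+) (s * y == y * t).
  by rewrite invMg (invS sS) nM (n_gen _ sS) eq_ts.
have nyts : n (y * t) s = (s * y == y * t).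
  by rewrite nM (negbTE nys) (n_gen _ tS) eq_st.
(* Appending t has the same effect on y and on s y unless s y = y t. *)
rewrite nsyt; have [syt|syNyt] := eqVneq (s * y) (y * t); last first.
  have nyts' : ~~ n (y * t) s by rewrite nyts (negbTE syNyt).
  rewrite addbF -mulgA (IHb (y * t)) // (IHb y) //.
  have boolE (A B C D d e : bool) :
      A || B && e || d && (C || D && e) = A || d && C || (B || d && D) && e.
    by move: A B C D d e; do 6!case.
  exact: boolE.
have nyt : n y^-1 t = false.
  apply/negP=> nyt; have := len_desc tS nyt.
  rewrite lenV -{1}(invS tS) -invMg lenV -syt.
  rewrite len_asc // => /eqP.
  by rewrite -addn2 -[X in X == _]addn0 eqn_add2l.
rewrite nyt /= -syt -mulgA.
have -> : s * (y * t) = y by rewrite -syt mulgA S2 // mul1g.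
rewrite !orbF !(IHb y) // mulgA S2 // mul1g inversion_gen_self //.
have boolE (A B e : bool) :
    [|| A, B | A && e] = A || B && ~~ e || (B || A && e) && e.
  by move: A B e; do 3!case.
exact: boolE.
Qed.

(** * Twisted identities *)

Variable theta : {perm W}.
Hypotheses (thetaM : {morph theta : x y / x * y}).
Hypotheses (thetaS : forall s, s \in S -> theta s \in S).
Hypotheses (thetaK : involutive theta).

Lemma theta1 : theta 1 = 1.
Proof. by apply: (mulgI (theta 1)); rewrite -thetaM !mulg1. Qed.

Lemma thetaV x : theta x^-1 = (theta x)^-1.
Proof. by apply: (mulgI (theta x)); rewrite -thetaM !mulgV theta1. Qed.

Lemma thetaJ x y : theta (x ^ y) = theta x ^ theta y.
Proof. by rewrite !conjgE !thetaM thetaV. Qed.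

Lemma inversion_theta w r : n (theta w) (theta r) = n w r.
Proof.
have [a [_ aS <-]] := reducedP w.
elim: a aS r => [|s a IHa] aS r.
  by rewrite big_nil theta1 !inversion1.
have [sS aS'] := sub_cons aS.
rewrite big_cons thetaM !inversion_gen ?thetaS //.
by rewrite -thetaJ IHa // (inj_eq perm_inj).
Qed.

Lemma len_theta w : len (theta w) = len w.
Proof.
suff le_theta x : len (theta x) <= len x.
  by apply/eqP; rewrite eqn_leq le_theta -{1}(thetaK w) le_theta.
have [a [<- aS <-]] := reducedP x.
have -> : theta (prodw a) = prodw [seq theta s | s <- a].
  by rewrite big_map; apply: (big_morph theta thetaM theta1).
rewrite -(size_map theta a); apply: len_le => _ /mapP[s /aS sS ->].
exact: thetaS.
Qed.

Definition twist s x := s * x * theta s.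

Lemma twistK s : s \in S -> involutive (twist s).
Proof.
move=> sS x; rewrite /twist !mulgA S2 // mul1g -mulgA S2 ?mulg1 //.
exact: thetaS.
Qed.

Lemma twist_fixed s x : s \in S -> (twist s x == x) = (s ^ x == theta s).
Proof.
move=> sS; rewrite conjgE -[in RHS](inj_eq (mulgI x)) mulKVg.
rewrite -[in RHS](inj_eq (mulIg (theta s))) -(mulgA x) S2 ?mulg1 //.
exact: thetaS.
Qed.

Local Notation twisted := (twisted_identities theta).
Local Notation rho := (rho S theta).
Local Notation fixedS := (fixed_gens S theta).

Lemma twisted_identityP x :
  reflect (exists u, x = u * theta u^-1) (x \in twisted).
Proof.
apply: (iffP imsetP) => [[w _ ->]|[u ->]].
  by exists (theta w^-1); rewrite thetaV invgK thetaK.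
by exists (theta u^-1); rewrite ?inE // thetaV invgK thetaK.
Qed.

Lemma twisted_identity1 : 1 \in twisted.
Proof. by apply/twisted_identityP; exists 1; rewrite invg1 theta1 mulg1. Qed.

Lemma twisted_identity_twist s x : s \in S ->
  (twist s x \in twisted) = (x \in twisted).
Proof.
move=> sS; suff twI y : y \in twisted ->
    twist s y \in twisted.
  by apply/idP/idP => [/twI|/twI //]; rewrite twistK.
case/twisted_identityP=> u ->; apply/twisted_identityP; exists (s * u).
by rewrite /twist invMg thetaM (invS sS) !mulgA.
Qed.

Lemma theta_twisted_identity x : x \in twisted -> theta x = x^-1.
Proof.
by case/twisted_identityP=> u ->; rewrite thetaM thetaK invMg thetaV invgK.
Qed.

Lemma inversion_twist s x : s \in S ->
  n (twist s x) s = if twist s x == x then n x s else ~~ n x s.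
Proof.
move=> sS; rewrite twist_fixed // /twist -mulgA inversion_gen_self //.
rewrite nM (n_gen _ (thetaS sS)).
by case: (s ^ x == theta s); case: (n x s).
Qed.

(** For x = u theta(u)^-1 the assumption says that theta fixes s^u, and then the contributions of u
    and theta(u)^-1 to the cocycle at s coincide and cancel. *)
Lemma fixed_twist_ascent s x : x \in twisted -> s \in S ->
  twist s x = x -> ~~ n x s.
Proof.
case/twisted_identityP=> u -> sS /eqP; rewrite twist_fixed // => /eqP fix_s.
have fix_r : theta (s ^ u) = s ^ u.
  by rewrite thetaJ -fix_s -conjgM thetaV mulgKV.
rewrite nM -fix_r inversion_theta inversionV conjgK.
by case: n.
Qed.

Lemma len_twist s x : s \in S -> theta x = x^-1 -> ~~ n x s -> twist s x != x ->
  len (twist s x) = (len x).+2.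
Proof.
move=> sS xV nxs; rewrite twist_fixed // => sNfix.
rewrite /twist -mulgA len_asc //; last first.
  by rewrite nM (negbTE nxs) (n_gen _ (thetaS sS)) (negbTE sNfix).
rewrite -lenV invMg invS ?thetaS //.
rewrite len_asc ?thetaS // ?lenV //.
by rewrite -xV inversion_theta.
Qed.

Lemma twist_descent s x : x \in twisted -> s \in S -> n x s ->
  len x = (len (twist s x)).+2.
Proof.
move=> xI sS nxs.
have xNfix : twist s x != x.
  by apply: contraL nxs => /eqP; apply: fixed_twist_ascent.
rewrite -{1}(twistK sS x) len_twist //.
- by apply: theta_twisted_identity; rewrite twisted_identity_twist.
- by rewrite inversion_twist // (negbTE xNfix) nxs.
- by rewrite twistK // eq_sym.
Qed.

Lemma starE w s :
  star theta w s = if twist (theta s) w == w then w * s else twist (theta s) w.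
Proof. by rewrite /star /twist thetaK. Qed.

Lemma len_star w s : s \in S -> len (star theta w s) <= (len w).+2.
Proof.
move=> sS; rewrite starE /twist thetaK; case: ifP => _.
  rewrite (leq_trans (len_mul _ _)) // -addn2 leq_add2l.
  by rewrite (leq_trans (len_gen sS)).
rewrite (leq_trans (len_mul _ _)) // -addn1 leq_add ?len_gen //.
by rewrite (leq_trans (len_mul _ _)) // -add1n leq_add2r len_gen ?thetaS.
Qed.

(** Going down by [twist] along descents lowers the length by 2 each time and gives a word of half
    the length; conversely a [star] step raises the length by at most 2. *)
Lemma len_rho x : x \in twisted -> len x = (rho x).*2.
Proof.
move=> xI; have [a [aS ax lenx]] : exists a,
    [/\ {subset a <= S}, foldl (star theta) 1 a = x & len x = (size a).*2].
  have [k] := ubnP (len x); elim: k x xI => // k IHk x xI ltk.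
  have [->|x1] := eqVneq x 1; first by exists [::]; rewrite len1.
  have [s sS nxs] := descent_ex x1.
  have lenx := twist_descent xI sS nxs.
  have [||a [aS ax lena]] := IHk (twist s x); first by rewrite twisted_identity_twist.
    by lia.
  (* [star] puts theta of its letter on the left, so the letter [theta s] is the one that undoes
     [twist s]. *)
  exists (rcons a (theta s)); split; last by rewrite size_rcons lenx lena.
    by move=> y; rewrite mem_rcons inE => /predU1P[->|/aS //]; apply: thetaS.
  rewrite foldl_rcons ax starE thetaK twistK // ifN //.
  by apply/eqP=> eqx; rewrite -eqx in lenx; lia.
have xa : reached_in (star theta) S (size a) x by apply/reached_inP; exists a.
have rho_le : rho x <= size a := min_steps_le xa.
have /reached_inP[b [szb bS bx]] := min_stepsP xa.
suff: len x <= (size b).*2 by rewrite szb -/(rho x); lia.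
rewrite -bx; elim/last_ind: b bS {szb bx} => [|b s IHb] bS; first by rewrite len1.
have [bS' sS] : {subset b <= S} /\ s \in S.
  split=> [y yb|]; apply: bS; rewrite mem_rcons inE ?eqxx // yb orbT //.
rewrite foldl_rcons size_rcons (leq_trans (len_star _ sS)) //.
by have leb := IHb bS'; lia.
Qed.

Lemma rho_twist_descent s x : x \in twisted -> s \in S -> n x s ->
  rho x = (rho (twist s x)).+1.
Proof.
move=> xI sS nxs; have := twist_descent xI sS nxs.
by rewrite !len_rho ?twisted_identity_twist //; lia.
Qed.

(** * The coefficient of t *)

Section Converse.
Import GRing.Theory Num.Theory.

Lemma coef_poincare (A : {set W}) (l : W -> nat) k :
  ((poincare A l)`_k)%R = (#|[set w in A | l w == k]|%:R)%R.
Proof.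
rewrite /poincare coef_sum -sum1_card natr_sum big_mkcond [RHS]big_mkcond /=.
apply: eq_bigr => w _; rewrite coefXn inE eq_sym.
by case: (w \in A) => //=; case: (l w == k).
Qed.

Lemma len_eq1 w : (len w == 1%N) = (w \in S).
Proof.
apply/eqP/idP => [lenw|wS].
  have [[|s [|? ?]] [sza aS <-]] := reducedP w; rewrite lenw // in sza.
  by rewrite big_seq1 aS ?mem_head.
apply/eqP; rewrite eqn_leq len_gen // lt0n len_eq0; apply/eqP=> w1.
by have := n_gen w wS; rewrite w1 inversion1 eqxx.
Qed.

Lemma orbit_sub s : s \in S -> [set s; theta s] \subset S.
Proof. by move=> sS; apply/subsetP=> x /set2P[]-> //; apply: thetaS. Qed.

Lemma longest_fixed s : s \in S ->
  theta (longest S [set s; theta s]) = longest S [set s; theta s].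
Proof.
move=> sS; have JS := orbit_sub sS.
have [wJ wall] := longestP JS.
have thetaJset x : x \in [set s; theta s] -> theta x \in [set s; theta s].
  by case/set2P=> ->; rewrite ?thetaK ?set21 ?set22.
apply: longest_unique => // [|x xJ].
  have [a [_ aJ <-]] := word_lengthP wJ.
  rewrite (big_morph theta thetaM theta1) big_seq.
  by apply: group_prod => x /aJ xJ; apply/mem_gen/thetaJset.
by rewrite -[x]thetaK inversion_theta; apply/wall/thetaJset.
Qed.

(** The generator t is an inversion of the longest element of its own orbit; if that element lies in
    W_J with J = {s, theta s}, then so does t, and a generator in W_J belongs to J. *)
Lemma longest_orbit_inj s t : s \in S -> t \in S ->
  longest S [set s; theta s] = longest S [set t; theta t] -> t \in [set s; theta s].
Proof.
move=> sS tS eq_st; have JS := orbit_sub sS.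
have [wJ _] := longestP JS; have [_ /(_ t)] := longestP (orbit_sub tS).
rewrite set21 -eq_st => /(_ isT) nwt.
exact: (parabolic_gen JS tS (inversion_parabolic JS wJ nwt)).
Qed.

Lemma twist1_inj s t : s \in S -> t \in S -> theta t != t ->
  twist s 1 = twist t 1 -> t \in [set s; theta s].
Proof.
move=> sS tS tN eq_st; have JS := orbit_sub sS.
apply: (parabolic_gen JS tS); apply: (@inversion_parabolic _ JS (twist s 1)).
  by rewrite /twist mulg1 groupM ?mem_gen ?set21 ?set22.
by rewrite eq_st inversion_twist // inversion1 ifN // twist_fixed // conjg1 eq_sym.
Qed.

Lemma factorization_commute :
    (poincare [set: W] len =
     poincare twisted rho * poincare (fixed_points theta) (word_length fixedS))%R ->
  forall s, s \in S -> commute s (theta s).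
Proof.
move=> fact s0 s0S; apply/eqP; apply: contraT => s0N.
(* [D] collects the fixed generators and [R] the member of smaller rank of each two-element orbit,
   so |S| = |D| + 2|R|. *)
pose D := [set s in S | theta s == s].
pose R := [set s in S | enum_rank s < enum_rank (theta s)].
have RNfix s : s \in R -> theta s != s.
  by rewrite inE => /andP[_]; apply: contraTneq => ->; rewrite ltnn.
have cardS : #|S| = #|D| + #|R| + #|R|.
  rewrite -[X in _ + X](card_imset _ (@perm_inj _ theta)).
  have -> : S = (D :|: R) :|: [set theta s | s in R].
    apply/setP=> s; rewrite !inE; case sS: (s \in S) => /=; last first.
      apply/esym/imsetP=> -[t]; rewrite inE => /andP[tS _] st.
      by rewrite st thetaS in sS.
    case: ltngtP => [_|gt|eq]; first by rewrite orbT.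
      rewrite orbF; apply/esym/orP; right; apply/imsetP; exists (theta s).
        by rewrite inE thetaS ?thetaK // sS.
      by rewrite thetaK.
    by rewrite -(inj_eq enum_rank_inj) -val_eqE /= eq eqxx.
  have dis1 : [disjoint D & R].
    rewrite disjoint_subset; apply/subsetP=> s; rewrite !inE => /andP[-> /eqP->].
    by rewrite ltnn.
  have dis2 : [disjoint D :|: R & [set theta s | s in R]].
    rewrite disjoint_subset; apply/subsetP=> s sDR; rewrite inE.
    apply/imsetP=> -[t tR st]; move: sDR; rewrite st !inE thetaK.
    have := RNfix t tR; move: tR; rewrite inE => /andP[_ ltt] tN.
    by rewrite [t == _]eq_sym (negbTE tN) andbF /= ltnNge (ltnW ltt) andbF.
  by rewrite !cardsU (disjoint_setI0 dis1) (disjoint_setI0 dis2) cards0 !subn0.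
have DS s : s \in D -> s \in S by rewrite inE => /andP[].
have RS s : s \in R -> s \in S by rewrite inE => /andP[].
have [r rR rN] : exists2 r, r \in R & r * theta r != theta r * r.
  have s0Nfix : theta s0 != s0 by apply: contraNneq s0N => ->.
  case: (ltngtP (enum_rank s0) (enum_rank (theta s0))) => [lt|gt|eq].
  - by exists s0; rewrite // inE s0S.
  - by exists (theta s0); rewrite ?inE ?thetaS ?thetaK // eq_sym.
  - by case/eqP: s0Nfix; apply/esym/enum_rank_inj/val_inj.
(* Different orbits supply different canonical generators of Fix(theta). *)
have fix1 : #|D| + #|R| <= #|[set w in fixed_points theta | word_length fixedS w == 1%N]|.
  have <- : #|D :|: R| = #|D| + #|R|.
    rewrite cardsU (_ : D :&: R = set0) ?cards0 ?subn0 //.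
    apply/setP=> s; rewrite !inE; apply/negP=> /andP[/andP[_ /eqP->]].
    by rewrite ltnn andbF.
  have inj : {in D :|: R &, injective (fun s => longest S [set s; theta s])}.
    move=> s t sDR tDR eq_st.
    have DRS u : u \in D :|: R -> u \in S by rewrite in_setU => /orP[/DS|/RS].
    have /set2P[->//|ts] := longest_orbit_inj (DRS s sDR) (DRS t tDR) eq_st.
    move: sDR tDR; rewrite ts !inE thetaK => /orP[/andP[_ /eqP->//]|/andP[_ lt]].
    case/orP=> /andP[_]; first by move/eqP.
    by rewrite ltnNge (ltnW lt).
  rewrite -(card_in_imset inj); apply: subset_leq_card; apply/subsetP=> _ /imsetP[s sDR ->].
  have sS : s \in S by move: sDR; rewrite in_setU => /orP[/DS|/RS].
  have wF : longest S [set s; theta s] \in fixedS by apply: imset_f.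
  rewrite !inE longest_fixed // eqxx /= eqn_leq.
  have := @word_length_le _ fixedS [:: longest S [set s; theta s]].
  rewrite big_seq1 => -> /=; last by move=> x /[!inE] /eqP->.
  rewrite lt0n word_length_eq0 ?mem_gen //.
  have [_ /(_ s)] := longestP (orbit_sub sS); rewrite set21 => /(_ isT) nws.
  by apply: contraTneq nws => ->; rewrite inversion1.
(* Each two-element orbit supplies the rank-one element s theta(s), and the non-commuting orbit of r
   supplies theta(r) r as well. *)
have iota1 : #|R|.+1 <= #|[set x in twisted | rho x == 1%N]|.
  have <- : #|theta r |: R| = #|R|.+1.
    rewrite cardsU1 (_ : _ \notin R) //; move: rR; rewrite !inE thetaK => /andP[_ lt].
    by rewrite ltnNge (ltnW lt) andbF.
  have inj : {in theta r |: R &, injective (fun s => twist s 1)}.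
    have memE u : u \in theta r |: R -> u \in S /\ theta u != u.
      case/setU1P=> [->|uR]; last by rewrite RS ?RNfix.
      by rewrite thetaS ?RS // thetaK eq_sym RNfix.
    move=> s t sR' tR' eq_st; have [[sS sN] [tS tN]] := (memE s sR', memE t tR').
    have /set2P[->//|ts] := twist1_inj sS tS tN eq_st.
    have comm_s : s * theta s = theta s * s.
      by move: eq_st; rewrite ts /twist !mulg1 thetaK.
    case/setU1P: sR' => [sr|sR].
      by rewrite sr thetaK in comm_s; rewrite comm_s eqxx in rN.
    case/setU1P: tR' => [|tR].
      rewrite ts => /perm_inj sr; by rewrite sr in comm_s; rewrite comm_s eqxx in rN.
    move: sR tR; rewrite ts !inE thetaK => /andP[_ lt] /andP[_].
    by rewrite ltnNge (ltnW lt).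
  rewrite -(card_in_imset inj); apply: subset_leq_card; apply/subsetP=> _ /imsetP[s sR' ->].
  have [sS sN] : s \in S /\ theta s != s.
    case/setU1P: sR' => [->|sR]; last by rewrite RS ?RNfix.
    by rewrite thetaS ?RS // thetaK eq_sym RNfix.
  have sI : twist s 1 \in twisted by rewrite twisted_identity_twist // twisted_identity1.
  rewrite inE sI /=.
  have : len (twist s 1) = 2.
    rewrite len_twist ?len1 ?invg1 ?theta1 ?inversion1 //.
    by rewrite twist_fixed // conjg1 eq_sym.
  by rewrite len_rho // => /eqP; rewrite -[2]/(1.*2) (inj_eq double_inj).
have iota0 : 0 < #|[set x in twisted | rho x == 0]|.
  apply/card_gt0P; exists 1; rewrite inE twisted_identity1 /=.
  by have := len_rho twisted_identity1; rewrite len1; case: rho.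
have fix0 : 0 < #|[set w in fixed_points theta | word_length fixedS w == 0]|.
  by apply/card_gt0P; exists 1; rewrite !inE theta1 word_length1 !eqxx.
(* With constant terms at least 1 in both factors, the coefficient of t in the product is at least
   (|D| + |R|) + (|R| + 1), which exceeds |S|. *)
move/(congr1 (fun p : {poly int} => p`_1)%R): fact.
rewrite coefM !big_ord_recr big_ord0 /= add0r !coef_poincare.
have -> : [set w in [set: W] | len w == 1%N] = S.
  by apply/setP=> w; rewrite !inE len_eq1.
rewrite -!natrM -natrD => /eqP; rewrite eqr_nat subn0 subnn cardS.
move: fix1 iota1 iota0 fix0.
move: #|D| #|R| #|[set w in fixed_points theta | word_length fixedS w == 1%N]|
  #|[set x in twisted | rho x == 1%N]| #|[set x in twisted | rho x == 0]|
  #|[set w in fixed_points theta | word_length fixedS w == 0]|.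
move=> d k F1 I1 I0 F0 leF leI I0_gt0 F0_gt0 /eqP eqS.
have leF1 := leq_pmull F1 I0_gt0; have leI1 := leq_pmulr I1 F0_gt0.
have := leq_add (leq_trans leF leF1) (leq_trans leI leI1).
by rewrite -eqS addnS ltnn.
Qed.

End Converse.

(** * Fixed points in the commuting case *)

Hypothesis commS : forall s, s \in S -> commute s (theta s).

(** The longest element of W_J for J = {s, theta s}, in closed form because the two generators
    commute; see [fixed_gensP]. *)
Definition orbit_gen s := if theta s == s then s else s * theta s.

Lemma theta_orbit_gen s : s \in S -> theta (orbit_gen s) = orbit_gen s.
Proof.
move=> sS; rewrite /orbit_gen; case: eqP => // _.
by rewrite thetaM thetaK; apply/esym/commS.
Qed.

Lemma orbit_gen_sqr s : s \in S -> orbit_gen s * orbit_gen s = 1.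
Proof.
move=> sS; rewrite /orbit_gen; case: eqP => _; first exact: S2.
have st : s * theta s = theta s * s by apply: commS.
by rewrite {1}st -mulgA (mulgA s) S2 // mul1g S2 // thetaS.
Qed.

Lemma inversion_orbit_gen s r : s \in S -> n (orbit_gen s) r = (r \in [set s; theta s]).
Proof.
move=> sS; rewrite in_set2 /orbit_gen; case: eqP => [->|/eqP sNt].
  by rewrite orbb n_gen.
rewrite inversion_gen // (n_gen _ (thetaS sS)).
have tJs : theta s ^ s = theta s.
  by apply/conjg_fixP/commgP/commute_sym/commS.
rewrite -{1}tJs (inj_eq (@conjg_inj _ s)).
by case: (eqVneq r s) => // ->; rewrite eq_sym (negbTE sNt).
Qed.

Lemma orbit_gen_fix s : s \in S -> s ^ orbit_gen s = s.
Proof.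
move=> sS; apply/conjg_fixP/commgP; rewrite /orbit_gen; case: ifP => _ //.
by apply: commuteM => //; apply: commS.
Qed.

Lemma inversion_orbit_mul s f : s \in S -> n (orbit_gen s * f) s = ~~ n f s.
Proof.
by move=> sS; rewrite nM inversion_orbit_gen // set21 orbit_gen_fix.
Qed.

Lemma inversion_fixed f s : theta f = f -> n f (theta s) = n f s.
Proof.
by move=> fF; rewrite -{1}fF inversion_theta.
Qed.

Lemma orbit_gen_parabolic s : orbit_gen s \in <<[set s; theta s]>>.
Proof.
by rewrite /orbit_gen; case: ifP => _; rewrite ?groupM ?mem_gen ?set21 ?set22.
Qed.

Lemma len_orbit_mul s f : s \in S -> theta f = f -> ~~ n f s ->
  len (orbit_gen s * f) = len (orbit_gen s) + len f.
Proof.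
move=> sS fF nfs; apply: (len_coset (orbit_sub sS)).
  by move=> x /set2P[]->; rewrite ?inversion_fixed.
exact: orbit_gen_parabolic.
Qed.

Lemma len_orbit_gen s : s \in S -> 0 < len (orbit_gen s).
Proof.
move=> sS; rewrite lt0n len_eq0; apply/eqP=> s1.
by have := inversion_orbit_gen s sS; rewrite set21 s1 inversion1.
Qed.

(** A descent s of a fixed element comes with the descent theta(s), so all of [orbit_gen s] splits
    off on the left and the length drops. *)
Lemma fixed_point_ind (P : W -> Prop) : P 1 ->
    (forall s f, s \in S -> theta f = f -> ~~ n f s -> P f ->
       P (orbit_gen s * f)) ->
  forall f, theta f = f -> P f.
Proof.
move=> P1 PM f; have [k] := ubnP (len f); elim: k f => // k IHk f ltk fF.
have [->//|f1] := eqVneq f 1.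
have [s sS nfs] := descent_ex f1.
have defp : orbit_gen s * (orbit_gen s * f) = f by rewrite mulgA orbit_gen_sqr ?mul1g.
have nps : ~~ n (orbit_gen s * f) s by rewrite inversion_orbit_mul // nfs.
have pF : theta (orbit_gen s * f) = orbit_gen s * f.
  by rewrite thetaM theta_orbit_gen // fF.
rewrite -defp; apply: PM => //; apply: IHk => //; rewrite -ltnS (leq_trans _ ltk) //.
have := len_orbit_mul sS pF nps; rewrite defp => ->.
by rewrite ltnS -[X in X < _]add0n ltn_add2r len_orbit_gen.
Qed.

(** Peeling off [orbit_gen s] either finds r in the orbit of s or conjugates r by this fixed
    element. *)
Lemma inversion_fixed_conj f r : theta f = f -> n f r ->
  exists s g, [/\ s \in S, theta g = g & r = s ^ g].
Proof.
move=> fF; elim/fixed_point_ind: fF r => [|s {}f sS fF nfs IHf] r.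
  by rewrite inversion1.
rewrite nM inversion_orbit_gen //; case: (boolP (r \in _)) => [rs _|_ /= /IHf].
  by exists r, 1; rewrite (subsetP (orbit_sub sS)) // theta1 conjg1.
case=> t [g [tS gF defr]]; exists t, (g * (orbit_gen s)^-1); split=> //.
  by rewrite thetaM thetaV theta_orbit_gen // gF.
by rewrite conjgM -defr conjgK.
Qed.

(* A longest element of Fix(theta) has every simple reflection as a descent, hence
   inverts all reflections. *)
Lemma fixed_longest : exists2 v, theta v = v & forall r, reflection r -> n v r.
Proof.
pose P f := theta f == f.
have P1 : P 1 by rewrite /P theta1.
case: (arg_maxnP (fun f => len f) P1) => v /eqP vF vmax; exists v => // r rr.
apply: (coset_max (subxx S)) => //; last by rewrite Sgen inE.
move=> s sS; apply: contraT => nvs.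
have /vmax : P (orbit_gen s * v) by rewrite /P thetaM theta_orbit_gen // vF.
rewrite /= len_orbit_mul // -[X in _ <= X]add0n leq_add2r leqNgt.
by rewrite len_orbit_gen.
Qed.

(** The longest fixed element inverts r, so r = s^g with g fixed, and theta(r) is theta(s)
    conjugated by the same g. *)
Lemma commute_reflection r : reflection r -> commute r (theta r).
Proof.
move=> rr; have [v vF vmax] := fixed_longest.
have [s [g [sS gF ->]]] := inversion_fixed_conj vF (vmax r rr).
by rewrite thetaJ gF /commute -!conjMg commS.
Qed.

(** With y = u theta(u)^-1 the equation reads s^u = theta(t^u), so s^u and t^u are a reflection and
    its image under theta. *)
Lemma commute_swapped y s t : y \in twisted -> s \in S ->
  s ^ y = theta t -> commute s t.
Proof.
case/twisted_identityP=> u -> sS.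
rewrite conjgM thetaV => /(canRL (conjgKV _)); rewrite -thetaJ // => su.
have := commute_reflection (reflectionJ u (reflection_gen sS)).
rewrite su thetaK -su /commute -!conjMg => /conjg_inj.
exact.
Qed.

(* The alternating word of length k in s and t that ends in t. *)
Definition alternating_to s t k :=
  if odd k then alternating t s k else alternating s t k.

Lemma alternating_toS s t k :
  alternating_to s t k.+1 = (if odd k then s else t) :: alternating_to s t k.
Proof. by rewrite /alternating_to /=; case: (odd k). Qed.

Lemma alternating_to_rcons s t k :
  alternating_to s t k.+1 = rcons (alternating_to t s k) t.
Proof.
rewrite {1}/alternating_to alternatingS [alternating s t k.+1]alternatingS /=.
by rewrite /alternating_to; case: (odd k).
Qed.

Lemma size_alternating_to s t k : size (alternating_to s t k) = k.
Proof. by rewrite /alternating_to; case: ifP => _; apply: size_alternating. Qed.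

Lemma alternating_to_sub s t k (J : {set W}) : s \in J -> t \in J ->
  {subset alternating_to s t k <= J}.
Proof. by move=> sJ tJ; rewrite /alternating_to; case: ifP => _; apply: alternating_sub. Qed.

(** * The Hecke module *)

Local Notation module := {ffun W -> {poly int}}.
Section Hecke.
Import GRing.Theory.
Local Open Scope ring_scope.
Implicit Types (v : module) (c : {poly int}).

Definition scale c v : module := [ffun x => c * v x].

Lemma scaleE c v x : scale c v x = c * v x.
Proof. by rewrite ffunE. Qed.

Lemma module_addE v v' x : (v + v') x = v x + v' x.
Proof. by rewrite ffunE. Qed.

Definition delta x : module := [ffun y => (y == x)%:R].

(* The generator T_s of the Hecke algebra with parameter q = 'X. For the group
   GL_2n over a field with q elements, these are the Hecke operators on the
   Sp_2n-invariant functions on the set of complete flags. *)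
Definition hecke s v : module :=
  [ffun x => if twist s x == x then 'X * v x
             else if n x s then v (twist s x) + ('X - 1) * v x
             else 'X * v (twist s x)].

Lemma heckeD s : {morph hecke s : v v' / v + v'}.
Proof.
by move=> v v'; apply/ffunP=> x; rewrite !ffunE; do 2?case: ifP => _; ring.
Qed.

Lemma hecke_scale s c v : hecke s (scale c v) = scale c (hecke s v).
Proof. by apply/ffunP=> x; rewrite !ffunE; do 2?case: ifP => _; ring. Qed.

Lemma hecke0 s : hecke s 0 = 0.
Proof. by apply/ffunP=> x; rewrite !ffunE; do 2?case: ifP => _; ring. Qed.

Local Notation act := (foldr hecke).

Lemma actD a : {morph act^~ a : v v' / v + v'}.
Proof. by move=> v v'; elim: a => //= s a ->; apply: heckeD. Qed.

Lemma act_scale a c v : act (scale c v) a = scale c (act v a).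
Proof. by elim: a => //= s a ->; apply: hecke_scale. Qed.

Lemma act0 a : act 0 a = 0.
Proof. by elim: a => //= s a ->; apply: hecke0. Qed.

Lemma delta_decomposition v : v = \sum_x scale (v x) (delta x).
Proof.
apply/ffunP=> y; rewrite sum_ffunE (bigD1 y) //= !ffunE eqxx mulr1.
rewrite big1 ?addr0 // => x xNy.
by rewrite !ffunE eq_sym (negbTE xNy) mulr0.
Qed.

Lemma scaleA c c' v : scale c (scale c' v) = scale (c * c') v.
Proof. by apply/ffunP=> x; rewrite !ffunE mulrA. Qed.

End Hecke.

Local Notation act := (foldr hecke).
Implicit Types v : module.

Lemma hecke_sqr s v : s \in S ->
  hecke s (hecke s v) = (scale 'X v + scale ('X - 1) (hecke s v))%R.
Proof.
move=> sS; apply/ffunP=> x; rewrite !ffunE.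
have := inversion_twist x sS.
rewrite (twistK sS x) [x == _]eq_sym.
by case: eqP => [->|_] nx; rewrite ?eqxx ?nx; case: (n x s); rewrite /=; ring.
Qed.

Lemma hecke_delta_fixed s x : s \in S -> twist s x = x ->
  hecke s (delta x) = scale 'X (delta x).
Proof.
move=> sS sx; apply/ffunP=> y; rewrite !ffunE.
have -> : (twist s y == x) = (y == x).
  by rewrite -{1}sx (inj_eq (inv_inj (twistK sS))).
by case: (eqVneq y x) => [->|_]; rewrite ?sx ?eqxx //; do 2?case: ifP => _; rewrite /=; ring.
Qed.

Lemma hecke_delta_ascent s x : s \in S -> twist s x != x -> ~~ n x s ->
  hecke s (delta x) = delta (twist s x).
Proof.
move=> sS sx nxs; apply/ffunP=> y; rewrite !ffunE.
have -> : (twist s y == x) = (y == twist s x).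
  by rewrite -{1}(twistK sS x) (inj_eq (inv_inj (twistK sS))).
case: (eqVneq y (twist s x)) => [->|yNsx].
  rewrite (twistK sS) eq_sym (negbTE sx).
  by rewrite inversion_twist // (negbTE sx) nxs /=; ring.
case: (eqVneq y x) => [->|_]; first by rewrite (negbTE sx) (negbTE nxs) /=; ring.
by do 2?case: ifP => _; rewrite /=; ring.
Qed.

Lemma hecke_support s v : s \in S ->
  (forall x, x \notin twisted -> v x = 0%R) ->
  forall x, x \notin twisted -> hecke s v x = 0%R.
Proof.
move=> sS v0 x xI; rewrite ffunE !v0 // ?twisted_identity_twist //.
by do 2?case: ifP => _; ring.
Qed.

(* If alternating words of length k ending in s and t act alike on v, they act alike
   on T_s v: peel off one letter of each word with the quadratic relation. *)
Lemma braid_hecke s t k v : s \in S -> t \in S ->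
  act v (alternating s t k) = act v (alternating t s k) ->
  act (hecke s v) (alternating s t k) = act (hecke s v) (alternating t s k).
Proof.
move=> sS tS; case: k => // k.
have act_rcons u a v' : act v' (rcons a u) = act (hecke u v') a by rewrite foldr_rcons.
have actS u x j v' :
    act v' (alternating u x j.+1) = hecke u (act v' (alternating x u j)).
  by [].
rewrite -!act_rcons => E; have [kodd|keven] := boolP (odd k).
  have -> : rcons (alternating s t k.+1) s = alternating s t k.+2.
    by rewrite [RHS]alternatingS /= kodd.
  rewrite actS -E actS hecke_sqr // -actS E.
  by rewrite !(alternatingS t) kodd !act_rcons hecke_sqr // actD !act_scale.
have -> : rcons (alternating t s k.+1) s = alternating t s k.+2.
  by rewrite [RHS]alternatingS /= keven.
rewrite actS E actS hecke_sqr // -actS -E.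
by rewrite !(alternatingS s) (negbTE keven) !act_rcons hecke_sqr // actD !act_scale.
Qed.

Lemma order_mulC s t : s \in S -> t \in S -> #[s * t] = #[t * s].
Proof. by move=> sS tS; rewrite -orderV invMg !invS. Qed.

Lemma alternating_reduced s t k : s \in S -> t \in S -> k < #[s * t] ->
  ~~ n (prodw (alternating s t k)) t.
Proof.
elim: k s t => [|k IHk] s t sS tS ltk.
  by rewrite big_nil inversion1.
apply/negP=> nt; have ns : n (prodw (alternating s t k.+1)) s.
  rewrite /= big_cons inversion_gen_self //.
  by apply: IHk => //; rewrite -order_mulC // ltnW.
have [v [_ lenv]] := dihedral_descent sS tS ns nt.
have : len (prodw (alternating s t k.+1)) <= k.+1.
  rewrite -[X in _ <= X](size_alternating s t k.+1).
  by apply/len_le/alternating_sub.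
by rewrite lenv leqNgt (leq_trans ltk) ?leq_addr.
Qed.

Lemma prod_alternating_to s t k : s \in S -> t \in S ->
  (s * t) ^+ k = 1 <-> prodw (alternating_to s t k) = prodw (alternating_to t s k).
Proof.
move=> sS tS; have E : (s * t) ^+ k = 1 <->
    prodw (alternating s t k) = prodw (alternating t s k).
  rewrite (prod_alternating _ sS tS); split=> [->|]; first by rewrite mul1g.
  by rewrite -[RHS]mul1g => /mulIg.
by rewrite /alternating_to; case: ifP => _ //; split=> [/E|/esym/E].
Qed.

(** * The braid relation at a point where neither s nor t is a descent *)

Section BottomOrbit.
Variables s t y : W.
Hypotheses (sS : s \in S) (tS : t \in S) (yI : y \in twisted).
Hypotheses (nys : ~~ n y s) (nyt : ~~ n y t).

Let J := [set s; t].
Let J' := [set theta s; theta t].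

Let JS : J \subset S. Proof. by apply/subsetP=> x /set2P[]->. Qed.
Let J'S : J' \subset S. Proof. by apply/subsetP=> x /set2P[]->; apply: thetaS. Qed.

Let yJ x : x \in J -> ~~ n y x. Proof. by case/set2P=> ->. Qed.

Let yJ' x : x \in J' -> ~~ n y^-1 x.
Proof.
rewrite -(theta_twisted_identity yI).
by case/set2P=> ->; rewrite inversion_theta.
Qed.

Let theta_gen g : g \in <<J>> -> theta g \in <<J'>>.
Proof.
case/word_lengthP=> a [_ aJ <-].
rewrite (big_morph theta thetaM theta1) big_seq.
apply: group_prod => x /aJ /set2P[]->; apply: mem_gen; [exact: set21 | exact: set22].
Qed.

Lemma double_coset_gen g x : g \in <<J>> -> g ^ y \in <<J'>> -> x \in J ->
  n g x -> x ^ y \in J'.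
Proof. exact: (double_coset_descent JS J'S yJ yJ'). Qed.

Definition conj_twist g := g * y * theta g^-1.

Lemma conj_twistM x g : conj_twist (x * g) = x * conj_twist g * theta x^-1.
Proof. by rewrite /conj_twist invMg thetaM !mulgA. Qed.

Lemma twist_conj_twist x g : x \in S -> twist x (conj_twist g) = conj_twist (x * g).
Proof. by move=> xS; rewrite conj_twistM (invS xS). Qed.

(** If [twist x] fixed this point, (x^g)^y would equal theta(x^g); if x were a descent of it,
    (x^g)^y would be an inversion of theta(g)^-1. Either would put (x^g)^y in W_J'. *)
Lemma hecke_conj_twist g x : g \in <<J>> -> x \in J -> ~~ n g x ->
    (x ^ g) ^ y \notin <<J'>> ->
  hecke x (delta (conj_twist g)) = delta (conj_twist (x * g)).
Proof.
move=> gJ xJ ngx xgN; have xS := subsetP JS _ xJ.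
rewrite -twist_conj_twist //; apply: hecke_delta_ascent => //.
  apply: contra xgN; rewrite twist_fixed // => /eqP xg.
  have -> : (x ^ g) ^ y = theta (x ^ g).
    rewrite thetaJ -xg -!conjgM /conj_twist thetaV.
    by rewrite mulgKV.
  by apply: theta_gen; apply: groupJ => //; apply: mem_gen.
rewrite /conj_twist -mulgA nM (negbTE ngx) nM.
rewrite (negbTE (coset_min JS yJ _ _)) /=.
- apply: contra xgN => nx.
  exact: (inversion_parabolic J'S (theta_gen (groupVr gJ)) nx).
- by apply: reflectionJ; apply: reflection_gen.
- by apply: groupJ => //; apply: mem_gen.
Qed.

Definition next_letter x z k : W := if odd k then x else z.

Lemma hecke_alternating x z k : x \in J -> z \in J -> k <= #[x * z] ->
    (forall i, i < k ->
       (next_letter x z i ^ prodw (alternating_to x z i)) ^ y \notin <<J'>>) ->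
  act (delta y) (alternating_to x z k) =
  delta (conj_twist (prodw (alternating_to x z k))).
Proof.
move=> xJ zJ; elim: k => [|k IHk] lek freek.
  by rewrite big_nil /conj_twist invg1 theta1 mul1g mulg1.
rewrite alternating_toS big_cons /= IHk ?(ltnW lek) //; last first.
  by move=> i ltik; apply: freek; apply: ltnW.
have xS := subsetP JS _ xJ; have zS := subsetP JS _ zJ.
apply: hecke_conj_twist; last exact: freek.
- by apply/prodw_gen/alternating_to_sub.
- by case: ifP.
by rewrite /alternating_to; case: ifP => _; apply: alternating_reduced => //;
   rewrite order_mulC.
Qed.

Lemma next_letter_gen x z k : x \in J -> z \in J ->
  next_letter x z k ^ prodw (alternating_to x z k) \in <<J>> /\
  reflection (next_letter x z k ^ prodw (alternating_to x z k)).
Proof.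
move=> xJ zJ; have bJ : next_letter x z k \in J by rewrite /next_letter; case: ifP.
split; last by apply: reflectionJ; apply: reflection_gen; apply: (subsetP JS).
by apply: groupJ; [apply: mem_gen | apply/prodw_gen/alternating_to_sub].
Qed.

Lemma reflection_neq1 r : reflection r -> r != 1.
Proof.
move=> rr; apply/eqP=> r1; have := inversion_self rr.
by rewrite r1 inversion1.
Qed.

(** By [double_coset_gen] no reflection of W_J is carried into W_J' by y, so every letter moves the
    basis vector upwards, and both words end at the twisted conjugate of y by the same element. *)
Lemma braid_free : (forall x, x \in J -> x ^ y \notin J') ->
  act (delta y) (alternating_to s t #[s * t]) =
  act (delta y) (alternating_to t s #[s * t]).
Proof.
move=> freeJ; have sJ : s \in J := set21 _ _; have tJ : t \in J := set22 _ _.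
have free x z i : x \in J -> z \in J ->
    (next_letter x z i ^ prodw (alternating_to x z i)) ^ y \notin <<J'>>.
  move=> xJ zJ; have [rJ rr] := next_letter_gen i xJ zJ.
  apply/negP=> ryJ.
  have [a aJ nra] := descent_parabolic JS rJ (reflection_neq1 rr).
  by have := double_coset_gen rJ ryJ aJ nra; rewrite (negbTE (freeJ a aJ)).
have le_st : #[s * t] <= #[t * s] by rewrite (order_mulC sS tS).
rewrite !hecke_alternating //; try by move=> i _; apply: free.
by congr (delta (conj_twist _)); apply/prod_alternating_to; rewrite // expg_order.
Qed.

(** Both sides apply the same word of length m(x,z) - 1, along which y moves freely. One applies x
    before it, the other a further letter after it; each extra letter meets a point fixed by its
    twist and contributes a factor q. *)
Lemma braid_half_fixed x z : x \in J -> z \in J -> J = [set x; z] ->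
    twist x y = y -> z ^ y \notin J' ->
  act (delta y) (alternating_to x z #[x * z]) =
  act (delta y) (alternating_to z x #[x * z]).
Proof.
move=> xJ zJ defJ xy zN; have xS := subsetP JS _ xJ; have zS := subsetP JS _ zJ.
have xyJ : x ^ y \in J'.
  move/eqP: xy; rewrite twist_fixed // => /eqP->.
  by case/set2P: xJ => ->; rewrite ?set21 ?set22.
have only_x r : r \in <<J>> -> r ^ y \in <<J'>> -> r != 1 -> n r x.
  move=> rJ ryJ r1; have [a aJ nra] := descent_parabolic JS rJ r1.
  have := double_coset_gen rJ ryJ aJ nra; rewrite defJ in aJ.
  by case/set2P: aJ nra => -> //; rewrite (negbTE zN).
case defm: #[x * z] (order_gt0 (x * z)) => [//|m] _.
have free i : i < m ->
    (next_letter x z i ^ prodw (alternating_to x z i)) ^ y \notin <<J'>>.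
  move=> ltim; set r := _ ^ prodw _; have [rJ rr] := next_letter_gen i xJ zJ.
  apply/negP=> ryJ; have nrx := only_x r rJ ryJ (reflection_neq1 rr).
  (* If x r were nontrivial, [only_x] would make x a descent of both r and x r, which is
     impossible. *)
  have : x * r = 1.
    apply/eqP; apply: contraT => /only_x; rewrite inversion_gen_self // nrx.
    apply; first by apply: groupM => //; apply: mem_gen.
    by rewrite conjMg; apply: groupM => //; apply: mem_gen.
  move/(canRL (mulKg _)); rewrite mulg1 invS // => defr.
  (* With r = x the two alternating words of length i + 1 have equal products, although i + 1 is
     less than the order of x z. *)
  have : prodw (alternating_to x z i.+1) = prodw (alternating_to z x i.+1).
    rewrite alternating_toS [alternating_to z x _]alternating_to_rcons.
    rewrite big_cons big_rcons /=.
    by rewrite -/(next_letter x z i) conjgC -/r defr.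
  move/prod_alternating_to => /(_ xS zS) /eqP; rewrite -order_dvdn defm.
  by move/dvdn_leq => /(_ isT); rewrite ltnNge ltim.
have eqm : prodw (alternating_to x z m.+1) = prodw (alternating_to z x m.+1).
  by apply/prod_alternating_to; rewrite // -defm expg_order.
rewrite [alternating_to z x _]alternating_to_rcons foldr_rcons hecke_delta_fixed //.
rewrite act_scale alternating_toS /= hecke_alternating ?defm //.
have bS : (if odd m then x else z) \in S by case: ifP.
apply: hecke_delta_fixed => //; rewrite twist_conj_twist //.
have -> : (if odd m then x else z) * prodw (alternating_to x z m) =
    prodw (alternating_to x z m) * x.
  move: eqm; rewrite alternating_toS [alternating_to z x _]alternating_to_rcons.
  by rewrite big_cons big_rcons.
rewrite /conj_twist invMg thetaM -(mulgA _ x) (thetaV x).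
by rewrite -{2}xy /twist (invS (thetaS xS)) !mulgA.
Qed.

Lemma swapped x z : x ^ y = theta z -> z ^ y = theta x.
Proof.
move/(congr1 theta); rewrite thetaJ thetaK => <-.
by rewrite (theta_twisted_identity yI) conjgKV.
Qed.

(** The cases record which of s and t conjugation by y carries into {theta s, theta t}: both fixed
    up to theta, both exchanged, exactly one, or none. *)
Lemma braid_bottom :
  act (delta y) (alternating_to s t #[s * t]) =
  act (delta y) (alternating_to t s #[s * t]).
Proof.
have sJ : s \in J := set21 _ _; have tJ : t \in J := set22 _ _.
have fixE x : x \in S -> x ^ y = theta x -> twist x y = y.
  by move=> xS /eqP; rewrite -twist_fixed // => /eqP.
have [->//|sNt] := eqVneq s t.
have [/set2P[sy|sy]|sN] := boolP (s ^ y \in J').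
- have [/set2P[ty|ty]|tN] := boolP (t ^ y \in J').
  + by case/eqP: sNt; apply: (@conjg_inj _ y); rewrite sy ty.
  + have fixed_act a : {subset a <= J} ->
        act (delta y) a = scale ('X ^+ size a)%R (delta y).
      elim: a => [|x a IHa] aJ /=.
        by apply/ffunP=> x; rewrite !ffunE GRing.mul1r.
      have [xJ aJ'] := sub_cons aJ.
      rewrite IHa // hecke_scale hecke_delta_fixed ?(subsetP JS) //.
        by rewrite scaleA GRing.exprSr.
      by case/set2P: xJ => ->; apply: fixE.
    by rewrite !fixed_act ?size_alternating_to //; apply: alternating_to_sub.
  + by apply: braid_half_fixed => //; apply: fixE.
(* In the exchanged case s and t commute, and T_s and T_t agree on the basis vector of y; the
   quadratic relation finishes the argument. *)
- have ty := swapped sy.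
  have st : commute s t.
    exact: (commute_swapped yI sS sy).
  have sNy : twist s y != y by rewrite twist_fixed // sy (inj_eq perm_inj) eq_sym.
  have tNy : twist t y != y by rewrite twist_fixed // ty (inj_eq perm_inj).
  have eqT : hecke t (delta y) = hecke s (delta y).
    rewrite !hecke_delta_ascent //; congr delta.
    rewrite /twist [s * y]conjgC [t * y]conjgC sy ty -!mulgA -!thetaM.
    by rewrite st.
  have -> : #[s * t] = 2.
    apply: nt_prime_order => //.
      by have s1 := S2 sS; have t1 := S2 tS; rewrite expgMn // !expg2 s1 t1 mulg1.
    by rewrite -eq_invg_mul invS.
  by rewrite /= eqT (hecke_sqr _ sS) -eqT (hecke_sqr _ tS).
have [/set2P[ty|ty]|tN] := boolP (t ^ y \in J').
- by have := swapped ty => sy; rewrite sy set22 in sN.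
- have := @braid_half_fixed t s tJ sJ.
  rewrite order_mulC // => ->//; first by rewrite /J setUC.
  exact: fixE.
by apply: braid_free => x /set2P[]->.
Qed.

End BottomOrbit.

(** A descent u in {s, t} gives delta_x = T_u delta_x' with x' shorter, and [braid_hecke] lifts the
    relation from x' to x; without such a descent [braid_bottom] applies. *)
Lemma braid_delta s t x : s \in S -> t \in S -> x \in twisted ->
  act (delta x) (alternating s t #[s * t]) = act (delta x) (alternating t s #[s * t]).
Proof.
move=> sS tS; have [k] := ubnP (len x); elim: k x => // k IHk x ltk xI.
have up u : u \in S -> n x u ->
    exists2 x', len x' < k & x' \in twisted /\ delta x = hecke u (delta x').
  move=> uS nxu; exists (twist u x).
    by rewrite -ltnS (leq_trans _ ltk) // ltnS (twist_descent xI uS nxu).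
  split; first by rewrite twisted_identity_twist.
  have xNfix : twist u x != x.
    apply: contraL nxu => /eqP.
    exact: fixed_twist_ascent.
  rewrite hecke_delta_ascent ?twistK //.
    by rewrite eq_sym.
  by rewrite inversion_twist // (negbTE xNfix) nxu.
have [nxs|nxs] := boolP (n x s).
  have [x' ltx [x'I ->]] := up s sS nxs.
  by apply: braid_hecke => //; apply: IHk.
have [nxt|nxt] := boolP (n x t).
  have [x' ltx [x'I ->]] := up t tS nxt.
  by apply/esym/braid_hecke => //; apply/esym/IHk.
have := braid_bottom sS tS xI nxs nxt.
by rewrite /alternating_to; case: ifP => _ ->.
Qed.

Definition stable v := forall x, x \notin twisted -> v x = 0%R.

Lemma braid s t v : s \in S -> t \in S -> stable v ->
  act v (alternating s t #[s * t]) = act v (alternating t s #[s * t]).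
Proof.
move=> sS tS v0; rewrite [v]delta_decomposition !(big_morph _ (actD _) (act0 _)).
apply: eq_bigr => x _; rewrite !act_scale; have [xI|xI] := boolP (x \in twisted).
  by rewrite braid_delta.
by rewrite v0 //; apply/ffunP=> y; rewrite !ffunE !GRing.mul0r.
Qed.

(** * Counting flags *)

Lemma reduced_word_ex w :
  exists a, [&& size a == len w, all [in S] a & prodw a == w].
Proof.
have [a [sza aS aw]] := reducedP w; exists a.
by rewrite sza aw !eqxx andbT; apply/allP.
Qed.

Definition reduced_word w := xchoose (reduced_word_ex w).

Lemma reduced_wordP w : [/\ size (reduced_word w) = len w,
  {subset reduced_word w <= S} & prodw (reduced_word w) = w].
Proof.
by have /and3P[/eqP sza /allP aS /eqP aw] := xchooseP (reduced_word_ex w).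
Qed.

(* The coefficient of [flag w] at x counts, over a field with 'X elements, the flags
   in the orbit of x lying in the Bruhat cell of w based at the closed orbit. *)
Definition flag w := act (delta 1) (reduced_word w).

Lemma stable_delta1 : stable (delta 1).
Proof.
move=> x xI; rewrite ffunE; case: eqP => // x1.
by rewrite x1 twisted_identity1 in xI.
Qed.

Lemma stable_hecke s v : s \in S -> stable v -> stable (hecke s v).
Proof. move=> sS v0 x xI; exact: (hecke_support sS v0 xI). Qed.

Lemma flag_prod a : {subset a <= S} -> size a = len (prodw a) ->
  flag (prodw a) = act (delta 1) a.
Proof.
move=> aS sza; have [szr rS rE] := reduced_wordP (prodw a).
apply: (matsumoto stable_hecke _ stable_delta1); rewrite ?rE //.
exact: braid.
Qed.

Lemma flag_mul s w : s \in S -> ~~ n w s -> flag (s * w) = hecke s (flag w).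
Proof.
move=> sS nws; have [szr rS rE] := reduced_wordP w.
have := @flag_prod (s :: reduced_word w); rewrite big_cons rE => -> //.
  by move=> x; rewrite inE => /predU1P[->|/rS].
by rewrite /= szr len_asc.
Qed.

Lemma flag1 : flag 1 = delta 1.
Proof. by have := @flag_prod [::]; rewrite big_nil => -> //; rewrite len1. Qed.

Import GRing.Theory.

(** Doubling both sums pairs i with phi(i), fixed points included, and 2 can be cancelled in
    [{poly int}]. *)
Lemma pair_sum (I : finType) (phi : I -> I) (P : pred I) (F G : I -> {poly int}) :
    involutive phi -> (forall i, P (phi i) = P i) ->
    (forall i, P i -> F i + F (phi i) = G i + G (phi i))%R ->
  (\sum_(i | P i) F i = \sum_(i | P i) G i)%R.
Proof.
move=> phiK Pphi FG.
have pairE (H : I -> {poly int}) :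
    ((\sum_(i | P i) H i) *+ 2 = \sum_(i | P i) (H i + H (phi i)))%R.
  rewrite big_split /= mulr2n; congr (_ + _)%R.
  rewrite (reindex_inj (inv_inj phiK)); exact: eq_bigl.
have eq2 : ((\sum_(i | P i) F i) *+ 2 = (\sum_(i | P i) G i) *+ 2)%R.
  by rewrite !pairE; apply: eq_bigr.
apply: (@mulIf _ (2%:R : {poly int})%R); last by rewrite !mulr_natr.
by rewrite -polyC_natr polyC_eq0.
Qed.

(** On each pair x, [twist s x] of distinct points the ranks differ by 1, which makes the weights
    q^rho an eigenvector of the transpose of T_s. *)
Lemma hecke_rho_sum s v : s \in S ->
  (\sum_(x in twisted) hecke s v x * 'X ^+ rho x =
   'X * \sum_(x in twisted) v x * 'X ^+ rho x)%R.
Proof.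
move=> sS; rewrite mulr_sumr; apply: (pair_sum (twistK sS)) => [x|x xI].
  exact: twisted_identity_twist.
have xsI : twist s x \in twisted by rewrite twisted_identity_twist.
rewrite !ffunE (twistK sS).
have nx := inversion_twist x sS.
have [sx|sNx] := eqVneq (twist s x) x; first by rewrite sx; ring.
rewrite (negbTE sNx) in nx; rewrite nx.
have [nxs|nxs] /= := boolP (n x s).
  rewrite (rho_twist_descent xI sS nxs) exprS.
  ring.
rewrite (negbTE nxs) /= in nx.
rewrite (rho_twist_descent xsI sS) ?nx //.
rewrite (twistK sS) exprS; ring.
Qed.

Lemma rho1 : rho 1 = 0.
Proof.
have := len_rho twisted_identity1.
by rewrite len1; case: rho.
Qed.

Lemma flag_rho_sum w : (\sum_(x in twisted) flag w x * 'X ^+ rho x = 'X ^+ len w)%R.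
Proof.
have [<- rS _] := reduced_wordP w; rewrite /flag.
elim: (reduced_word w) rS => [|s a IHa] aS.
  rewrite (bigD1 1) ?twisted_identity1 //= ffunE eqxx mul1r rho1.
  by rewrite big1 ?addr0 // => x /andP[_ /negbTE x1]; rewrite ffunE x1 mul0r.
by have [sS aS'] := sub_cons aS; rewrite /= hecke_rho_sum // IHa // exprS.
Qed.

Definition flag_sum x := (\sum_w flag w x)%R.

(** This is T_s (sum of all T_w) = q (sum of all T_w), checked on the pairs w, s w with the
    quadratic relation. *)
Lemma hecke_flag_sum s x : s \in S ->
  (\sum_w hecke s (flag w) x = 'X * flag_sum x)%R.
Proof.
move=> sS; rewrite /flag_sum mulr_sumr.
have sK : involutive (fun w => s * w) by move=> w; rewrite mulgA S2 // mul1g.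
apply: (pair_sum sK) => // w _.
have flag_mul' u := @flag_mul s u sS.
have [nws|nws] := boolP (n w s); last first.
  rewrite flag_mul' // hecke_sqr //.
  by rewrite module_addE !scaleE; ring.
have nsws : ~~ n (s * w) s by rewrite inversion_gen_self // nws.
have := flag_mul' _ nsws; rewrite sK => ->.
rewrite hecke_sqr //.
by rewrite module_addE !scaleE; ring.
Qed.

(** At an ascent x that is moved by [twist s], T_s evaluates a function as q times its value at
    [twist s x]; invariance equates this with q times the value at x. *)
Lemma flag_sum_twist s x : s \in S -> flag_sum (twist s x) = flag_sum x.
Proof.
move=> sS; wlog nxs : x / ~~ n x s => [IH|].
  have [nxs|/IH //] := boolP (n x s).
  have [->//|sNx] := eqVneq (twist s x) x.
  rewrite -{2}(twistK sS x); apply/esym/IH.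
  by rewrite inversion_twist // (negbTE sNx) nxs.
have [->//|sNx] := eqVneq (twist s x) x.
have := hecke_flag_sum x sS.
under eq_bigr do rewrite ffunE (negbTE sNx) (negbTE nxs).
by rewrite -mulr_sumr => /mulfI; apply; rewrite polyX_eq0.
Qed.

Lemma flag_sum_const x : x \in twisted -> flag_sum x = flag_sum 1.
Proof.
case/twisted_identityP=> u ->.
have [a [_ aS <-]] := reducedP u.
elim: a aS => [|s a IHa] aS; first by rewrite big_nil invg1 theta1 mulg1.
have [sS aS'] := sub_cons aS; rewrite -IHa // -[in RHS](flag_sum_twist _ sS).
by rewrite big_cons /twist invMg thetaM (invS sS) !mulgA.
Qed.

(** Every branch of [hecke] exhibits a point where the shorter product is nonzero. From there
    [right_support_mull] accounts for s on the left and the definition of [right_support] for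
    theta(s) on the right. *)
Lemma flag_support a y : {subset a <= S} -> size a = len (prodw a) ->
    act (delta 1) a y != 0%R ->
  right_support y [seq theta s | s <- a] (prodw a).
Proof.
elim: a y => [|s a IHa] y aS sza.
  by rewrite big_nil ffunE /=; case: (y == 1) => //; rewrite eqxx.
have [sza' nws] := reduced_cons aS sza.
have [sS aS'] := sub_cons aS.
have {}nws : ~~ n (prodw a) s.
  by move: nws; rewrite big_cons inversion_gen_self.
have bS : {subset [seq theta t | t <- a] <= S}.
  by move=> _ /mapP[t /aS' tS ->]; apply: thetaS.
have {}IHa := IHa _ aS' sza'; set b := [seq theta t | t <- a] in IHa bS *.
have v0 : stable (act (delta 1) a).
  apply: (stable_foldr _ aS' stable_delta1).
  exact: stable_hecke.
rewrite big_cons /= -/b; set v := act (delta 1) a in IHa v0 *; set w := prodw a in IHa nws *.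
have ssw x : s * (s * x) = x by rewrite mulgA S2 // mul1g.
have twistE x : s * (twist s x) = x * theta s by rewrite /twist -!mulgA ssw.
have mullE x u : ~~ n x s -> right_support (s * x) b u =
    right_support x b (s * u) || right_support x b u && n u s.
  by move=> nxs; apply: right_support_mull.
have mull x : ~~ n x s -> right_support x b w -> right_support (s * x) b (s * w).
  by move=> nxs xw; rewrite mullE // ssw xw.
have mullV x : ~~ n x s -> right_support (s * x) b w -> right_support x b (s * w).
  by move=> nxs; rewrite mullE // (negbTE nws) andbF orbF.
rewrite ffunE; have [sy|sNy] := eqVneq (twist s y) y => [|].
  rewrite mulf_eq0 negb_or => /andP[_ vy].
  have yI : y \in twisted by apply: contraR vy => /v0->.
  have nys := fixed_twist_ascent yI sS sy.
  by rewrite -twistE sy mull // IHa.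
have nyE := inversion_twist y sS; rewrite (negbTE sNy) in nyE.
have [nys|nys] := boolP (n y s); last first.
  rewrite mulf_eq0 negb_or => /andP[_ vy]; rewrite mullV //.
    by rewrite -inversion_gen_self // -twistE ssw nyE.
  by rewrite -twistE ssw IHa.
have [vsy|vsy _] := eqVneq (v (twist s y)) 0%R; last first.
  by rewrite -twistE mull ?nyE ?nys // IHa.
(* Only the term (q - 1) v(y) survives. Here theta(s) is a right descent of y, so the branch of
   [right_support] that keeps y is open. *)
rewrite vsy add0r mulf_eq0 negb_or => /andP[_ vy].
have yI : y \in twisted by apply: contraR vy => /v0->.
have nyV : n y^-1 (theta s).
  rewrite -(theta_twisted_identity yI).
  by rewrite inversion_theta.
rewrite nyV /=; apply/orP; right.
have nsy : ~~ n (s * y) s by rewrite inversion_gen_self // nys.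
have suppV : right_support (s * y) b (s * w).
  by apply: mullV => //; rewrite ssw IHa.
by rewrite -[X in right_support X](ssw y) mullE // suppV inversion_gen_self // nws orbT.
Qed.

(** At y = 1 the product T_y T_theta(w) is T_theta(w) alone. *)
Lemma flag_fixed w : flag w 1 != 0%R -> theta w = w.
Proof.
have [szr rS rE] := reduced_wordP w.
move=> fw; have := @flag_support (reduced_word w) 1 rS; rewrite rE => /(_ szr fw).
set a := reduced_word w in szr rS rE *.
have mapE : prodw [seq theta s | s <- a] = theta w.
  by rewrite big_map -rE; apply/esym/(big_morph theta thetaM theta1).
move/right_support_reduced; rewrite mapE !mul1g => wE; apply/esym/wE.
- by move=> _ /mapP[t /rS tS ->]; apply: thetaS.
- by rewrite len1 size_map szr len_theta.
Qed.

(** If theta(s) = s, then T_s delta_1 = q delta_1. Otherwise T_s and T_theta(s) agree on delta_1,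
    and the quadratic relation leaves q delta_1 plus a multiple of T_s delta_1; the latter
    contributes 0 because f s is not fixed by theta. *)
Lemma flag_mulr s f : s \in S -> theta f = f -> ~~ n f^-1 s ->
  flag (f * orbit_gen s) 1 = ('X * flag f 1%g)%R.
Proof.
move=> sS fF nfs; have [sza aS aE] := reduced_wordP f.
rewrite {2}/flag; set a := reduced_word f in sza aS aE *.
have flagE b : {subset b <= S} -> size b = len (prodw b) -> flag (prodw b) = act (delta 1) b.
  exact: flag_prod.
have len_mulr x u : u \in S -> ~~ n x^-1 u -> len (x * u) = (len x).+1.
  move=> uS nxu; rewrite -lenV invMg (invS uS).
  by rewrite len_asc // lenV.
have rconsS u b : u \in S -> {subset b <= S} -> {subset rcons b u <= S}.
  by move=> uS bS x; rewrite mem_rcons inE => /predU1P[->|/bS].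
have fs_reduced : size (rcons a s) = len (prodw (rcons a s)).
  by rewrite size_rcons big_rcons aE len_mulr // sza.
rewrite /orbit_gen; case: eqP => [sF|/eqP sNF].
  have -> : f * s = prodw (rcons a s) by rewrite big_rcons aE.
  rewrite flagE //; last exact: rconsS.
  rewrite foldr_rcons (hecke_delta_fixed sS) ?act_scale ?scaleE //.
  by rewrite /twist sF mulg1 S2.
have nfts : ~~ n (f * s)^-1 (theta s).
  rewrite invMg (invS sS) inversion_gen // (negbTE sNF) /=.
  have -> : theta s ^ s = theta s.
    by apply/conjg_fixP/commgP/commute_sym/commS.
  rewrite inversion_fixed //.
  by rewrite thetaV fF.
have -> : f * (s * theta s) = prodw (rcons (rcons a s) (theta s)).
  by rewrite !big_rcons aE mulgA.
rewrite flagE; last 2 first.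
- by apply: (rconsS); [apply: thetaS | apply: rconsS].
- by rewrite size_rcons fs_reduced !big_rcons aE [in RHS]len_mulr ?thetaS.
have s1 : twist s 1 = s * theta s by rewrite /twist mulg1.
have t1 : twist (theta s) 1 = s * theta s.
  by rewrite /twist mulg1 thetaK; apply/esym/commS.
have st1 : s * theta s != 1 by rewrite -eq_invg_mul invS // eq_sym.
rewrite !foldr_rcons.
have -> : hecke (theta s) (delta 1) = hecke s (delta 1).
  by rewrite !hecke_delta_ascent ?s1 ?t1 ?inversion1 ?thetaS.
rewrite hecke_sqr // actD !act_scale module_addE.
rewrite !scaleE -foldr_rcons -(flagE (rcons a s)) //; last exact: rconsS.
have [->|/flag_fixed] := eqVneq (flag (prodw (rcons a s)) 1) 0%R.
  by rewrite mulr0 addr0.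
rewrite big_rcons aE thetaM fF => /mulgI /eqP.
by rewrite (negbTE sNF).
Qed.

Lemma fixed_gensP w : reflect (exists2 s, s \in S & w = orbit_gen s) (w \in fixedS).
Proof.
have longestE s : s \in S -> longest S [set s; theta s] = orbit_gen s.
  move=> sS; apply/esym/longest_unique.
  - exact: orbit_sub.
  - exact: orbit_gen_parabolic.
  - move=> x xJ; rewrite inversion_orbit_gen //.
by apply: (iffP imsetP) => [[s sS ->]|[s sS ->]]; exists s; rewrite ?longestE.
Qed.

Lemma flag_fixed_word f : theta f = f ->
  exists a, [/\ {subset a <= fixedS}, prodw a = f & flag f 1 = ('X ^+ size a)%R].
Proof.
(* Inverses reconcile [fixed_point_ind], which extends on the left, with [flag_mulr], which extends
   on the right. *)
move=> fF; rewrite -(invgK f); have : theta f^-1 = f^-1 by rewrite thetaV fF.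
move: f^-1 => {fF}g gF; elim/fixed_point_ind: gF => [|s {}g sS gF ngs [a [aF aE fa]]].
  by exists [::]; rewrite big_nil invg1 flag1 ffunE eqxx.
exists (rcons a (orbit_gen s)).
have sV : (orbit_gen s)^-1 = orbit_gen s.
  by apply: (mulgI (orbit_gen s)); rewrite mulgV orbit_gen_sqr.
rewrite big_rcons invMg sV size_rcons; split.
- by move=> x; rewrite mem_rcons inE => /predU1P[->|/aF //]; apply/fixed_gensP; exists s.
- by rewrite aE.
rewrite flag_mulr ?fa ?exprS //.
  by rewrite thetaV gF.
by rewrite invgK.
Qed.

Lemma fixed_prod a : {subset a <= fixedS} -> theta (prodw a) = prodw a.
Proof.
elim: a => [|x a IHa] aF; first by rewrite big_nil theta1.
have [/fixed_gensP[s sS ->] aF'] := sub_cons aF.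
by rewrite big_cons thetaM IHa // theta_orbit_gen.
Qed.

(** Appending a canonical generator to a fixed element changes the exponent by exactly 1, up or
    down, so the exponent never exceeds the size of the word. *)
Lemma flag_word_le a : {subset a <= fixedS} ->
  exists2 j, j <= size a & flag (prodw a) 1 = ('X ^+ j)%R.
Proof.
elim/last_ind: a => [|a x IHa] aF.
  by exists 0; rewrite // big_nil flag1 ffunE eqxx.
have [aF' /fixed_gensP[s sS defx]] : {subset a <= fixedS} /\ x \in fixedS.
  by split=> [y ya|]; apply: aF; rewrite mem_rcons inE ?eqxx // ya orbT.
have [j lej fj] := IHa aF'; have pF := fixed_prod aF'.
rewrite big_rcons size_rcons defx; set f := prodw a in pF fj *.
have ss : f * orbit_gen s * orbit_gen s = f.
  by rewrite -mulgA orbit_gen_sqr ?mulg1.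
have flagM := flag_mulr sS.
have [nfs|nfs] := boolP (n f^-1 s); last first.
  by exists j.+1; rewrite // flagM // fj exprS.
have sV : (orbit_gen s)^-1 = orbit_gen s.
  by apply: (mulgI (orbit_gen s)); rewrite mulgV orbit_gen_sqr.
have fsF : theta (f * orbit_gen s) = f * orbit_gen s.
  by rewrite thetaM pF theta_orbit_gen.
have nfsV : ~~ n (f * orbit_gen s)^-1 s.
  by rewrite invMg sV inversion_orbit_mul // nfs.
have [b [_ _ fb]] := flag_fixed_word fsF; exists (size b) => //.
have := flagM _ fsF nfsV; rewrite ss fj fb -exprS => /(congr1 (size : {poly int} -> nat)).
by rewrite !size_polyXn => -[jb]; rewrite jb in lej; rewrite leqW // ltnW.
Qed.

(** Some word attains the exponent and no word is shorter, so it is the minimal size. *)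
Lemma flag_fixed_length f : theta f = f ->
  flag f 1 = ('X ^+ word_length fixedS f)%R.
Proof.
move=> fF; have [a [aF aE fa]] := flag_fixed_word fF.
have fgen : f \in <<fixedS>> by rewrite -aE prodw_gen.
have [b [szb bF bE]] := word_lengthP fgen.
have [j lej fj] := flag_word_le bF; rewrite bE in fj.
have ja : j = size a.
  by move: fa; rewrite fj => /(congr1 (size : {poly int} -> nat)); rewrite !size_polyXn => -[].
rewrite fj; congr ('X ^+ _)%R; apply/eqP; rewrite eqn_leq -{1}szb lej ja.
by rewrite -{1}aE word_length_le.
Qed.

Lemma poincare_factorization :
  (poincare [set: W] len =
   poincare twisted rho * poincare (fixed_points theta) (word_length fixedS))%R.
Proof.
rewrite /poincare.
(* Elements not fixed by theta contribute 0 at 1, so the second factor is [flag_sum 1]; since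
   [flag_sum] is constant on twisted identities, it can enter the sum over x. *)
have -> : (\sum_(f in fixed_points theta) 'X ^+ word_length fixedS f = flag_sum 1%g)%R.
  rewrite /flag_sum [RHS](bigID [pred w | theta w == w]) /= [X in (_ + X)%R]big1 ?addr0.
    by apply: eq_big => [f|f]; rewrite inE // => /eqP fF; rewrite flag_fixed_length.
  move=> w; apply: contraNeq => /flag_fixed->.
  exact: eqxx.
rewrite mulr_suml.
under [RHS]eq_bigr => x xI.
  rewrite -(flag_sum_const xI) /flag_sum mulr_sumr.
  over.
rewrite exchange_big; apply: eq_big => [w|w _]; first by rewrite inE.
rewrite -(flag_rho_sum w).
by apply: eq_bigr => x _; rewrite mulrC.
Qed.

End Coxeter.

Theorem theorem5p2 (W : finGroupType) (S : {set W}) (theta : {perm W})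
    (coxWS : coxeter_system S) (autTheta : coxeter_aut S theta)
    (thetaK : involutive theta) :
  let factors :=
    poincare [set: W] (word_length S) =
      (poincare (twisted_identities theta) (rho S theta) *
       poincare (fixed_points theta) (word_length (fixed_gens S theta)))%R in
  (factors <->
     (forall s, s \in S -> #[s * theta s] = 1%N \/ #[s * theta s] = 2))
  /\ (factors <-> (forall s, s \in S -> commute s (theta s))).
Proof.
move=> factors; have [n n_cocycle] := inversion_cocycle_ex coxWS.
have [order2 Sgen _] := coxWS; have [autT TS] := autTheta.
have S2 s : s \in S -> s * s = 1 by move/order2=> s2; rewrite -(expg_order s) s2.
have thetaM : {morph theta : x y / x * y}.
  by move=> x y; have /morphicP-> := Aut_morphic autT; rewrite ?inE.
have thetaS s : s \in S -> theta s \in S by move=> sS; rewrite -TS imset_f.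
have comm : factors <-> (forall s, s \in S -> commute s (theta s)).
  split; first exact: (factorization_commute S2 Sgen n_cocycle thetaM thetaS thetaK).
  exact: (poincare_factorization S2 Sgen n_cocycle thetaM thetaS thetaK).
split=> //; apply: (iff_trans comm); split=> commS s sS; have tS := thetaS s sS.
  have [st1|st1] := eqVneq (s * theta s) 1; [left; rewrite st1 | right].
    exact: order1.
  apply: nt_prime_order => //.
  rewrite expgMn; last exact: commS.
  by have := (S2 s sS, S2 _ tS); rewrite !expg2 => -[-> ->]; rewrite mulg1.
(* Order 1 or 2 makes s theta(s) equal to its own inverse, which is theta(s) s. *)
have st2 : s * theta s * (s * theta s) = 1.
  case: (commS s sS) (expg_order (s * theta s)) => -> // st1.
  by rewrite [s * theta s]st1 mulg1.
have sV u : u \in S -> u^-1 = u by move=> uS; apply: (mulgI u); rewrite mulgV S2.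
rewrite /commute -[RHS]invgK invMg (sV s) // (sV (theta s)) //.
by apply/eqP; rewrite eq_sym eq_invg_mul st2.
Qed.
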